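(* Fix $k\in\mathbb{N}$ and $\beta\in(0,\infty)$, and let $\alpha=\beta\sqrt{n}$. For a $k$-out map $M$ on $[n]$ with in-degrees $D_1(M),\dots,D_n(M)$, let $X(M)=\sum_{i=1}^n D_i(M)^2$. Then $$\lim_{n\to\infty} d_{TV}\bigl(X(M_{n,k}^{\alpha}),X(M_{n,k}^{\infty})\bigr)=\tfrac12\,\mathbb{E}\bigl|1-\exp(-\mathcal{N})\bigr|,$$ where $\mathcal{N}$ is a Gaussian random variable with $\mathbb{E}[\mathcal{N}]=\frac{k^2}{4\beta^2}$ and $\mathrm{Var}[\mathcal{N}]=\frac{k^2}{2\beta^2}$, and $d_{TV}$ denotes the total variation distance between the laws of the two integer-valued random variables.
   Context: A $k$-out map on $[n]$ is a map $M:[n]\to[n]^k$, viewed as a digraph on $[n]$ in which each vertex has $k$ out-arcs labeled $1,\dots,k$. The in-degree $D_j(M)$ of vertex $j$ is the total number of coordinates, over all vertices $i$ and all $k$ labels, of $M(i)$ equal to $j$. For $\alpha\in(0,\infty)$, the random $k$-out map $M_{n,k}^{\alpha}$ is generated by inserting $kn$ out-arcs, $k$ per vertex: every vertex starts with weight $\alpha$; at each step a vertex whose out-degree is below $k$ picks its next image $j$ with probability proportional to the current weight of $j$, and the weight of $j$ then increases by $1$. Its law is $P(M_{n,k}^{\alpha}=M)=\prod_{j=1}^n \alpha^{\overline{d_j}}/(\alpha n)^{\overline{kn}}$, where $(d_1,\dots,d_n)$ is the in-degree sequence of $M$ and $x^{\overline{y}}=x(x+1)\cdots(x+y-1)$.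 $M_{n,k}^{\infty}$ denotes the uniformly random $k$-out map on $[n]$ (probability $n^{-kn}$ each). *)

(* Defs.v *)
From HB Require Import structures.
From mathcomp Require Import all_boot all_order all_algebra.
From mathcomp Require Import all_classical all_reals all_analysis.
Set Implicit Arguments. Unset Strict Implicit. Unset Printing Implicit Defensive.
Import Order.TTheory GRing.Theory Num.Theory.
Local Open Scope ring_scope.

(* A k-out map on [n] = {0,...,n-1}: each vertex i gets a k-tuple of images
   (its out-arcs labelled 1..k). *)
Definition kmap (n k : nat) := {ffun 'I_n -> k.-tuple 'I_n}.

Definition indeg (n k : nat) (M : kmap n k) (j : 'I_n) : nat :=
  (\sum_(i < n) count_mem j (M i))%N.

Definition Xsq (n k : nat) (M : kmap n k) : nat :=
  (\sum_(j < n) (indeg M j) ^ 2)%N.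

Definition rising {R : realType} (x : R) (y : nat) : R :=
  \prod_(i < y) (x + i%:R).

Definition law_alpha {R : realType} (n k : nat) (alpha : R) (M : kmap n k) : R :=
  (\prod_(j < n) rising alpha (indeg M j)) / rising (alpha * n%:R) (k * n).

Definition law_unif {R : realType} (n k : nat) (M : kmap n k) : R :=
  (n%:R ^+ (k * n))^-1.

Definition lawX {R : realType} (n k : nat) (P : kmap n k -> R) (x : nat) : R :=
  \sum_(M : kmap n k | Xsq M == x) P M.

Definition dTV_X {R : realType} (n k : nat) (P Q : kmap n k -> R) : R :=
  2^-1 * \sum_(x <- undup [seq Xsq M | M <- enum (kmap n k)])
           `|lawX P x - lawX Q x|.

(* Main.v *)
Require Import Defs.
From HB Require Import structures.
From mathcomp Require Import all_boot all_order all_algebra.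
From mathcomp Require Import all_classical all_reals all_analysis.
From mathcomp Require Import measurable_realfun ring lra zify.
Set Implicit Arguments. Unset Strict Implicit. Unset Printing Implicit Defensive.
Import Order.TTheory GRing.Theory Num.Theory numFieldTopology.Exports.
Import numFieldNormedType.Exports.
Local Open Scope ring_scope.
Local Open Scope classical_set_scope.

(* Seen from the uniform map, the in-degrees are the occupancy numbers d of m = kn balls thrown
   one by one into n bins, and the preferential law has a density L(d). Expanding log L with
   alpha = beta sqrt n gives log L = - mu - S + o(1) in L^1, where mu = k^2/(4 beta^2) and
   S = (E A_2 - A_2)/alpha, A_2 being the number of colliding pairs of balls; this only uses the
   concentration of the numbers A_r of r-fold collisions. The process A_2 - E A_2 is a martingale
   with asymptotically deterministic conditional variances, so Lindeberg's replacement of one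
   increment after the other by Gaussian ones shows that S is asymptotically Gaussian with
   variance k^2/(2 beta^2). As S is a function of X = 2 A_2 + kn, the total variation distance of
   the laws of X is squeezed: with psi(x) = min(1, exp(-x)),
     E min(1, L) <= 1 - d_TV <= E min(1, g) + E (L - K)^+ + o(1),   g = exp(- mu - S),
   for every truncation level K. The first terms converge to E psi(N), and the tail
   E (L - K)^+ = 1 - E min(L, K) is asymptotically at most E exp(-2N)/(4K), which vanishes as K
   grows because E exp(-N) = 1. Finally |1 - y| = 1 + y - 2 min(1, y). *)

(** * Gaussian integrals: densities, convolution, exponential moments, domination *)

Section Gaussian.
Context {R : realType}.
Implicit Types (m s x y v : R).
Local Notation mu := (@lebesgue_measure R).
Local Notation nu := (@normal_prob R 0 1).

(** The Radon-Nikodym derivative of the Gaussian law and its explicit density have the same integral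
    over every measurable set, so they agree almost everywhere and may be exchanged under the
    integral. *)
Lemma ge0_integral_normal_prob m s (h : R -> \bar R) :
  measurable_fun [set: R] h -> (forall x, 0 <= h x)%E ->
  (\int[normal_prob m s]_x h x = \int[mu]_x (h x * (normal_pdf m s x)%:E))%E.
Proof.
move=> mh h0; have dom := normal_prob_dominates m s.
rewrite -(Radon_Nikodym_SigmaFinite.change_of_variables dom)//.
apply: ae_eq_integral => //.
- apply: emeasurable_funM => //.
  exact: measurable_int (Radon_Nikodym_SigmaFinite.f_integrable dom).
- apply: emeasurable_funM => //.
  by apply: measurableT_comp => //; exact: measurable_normal_pdf.
- apply: ae_eqe_mul2l; apply: integral_ae_eq => //.
  + exact: Radon_Nikodym_SigmaFinite.f_integrable.
  + by apply: measurableT_comp => //; exact: measurable_normal_pdf.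
  + by move=> E _ mE; rewrite -Radon_Nikodym_SigmaFinite.f_integral.
Qed.

Lemma normal_peakE s : 0 < s -> normal_peak s = (s * Num.sqrt (pi *+ 2))^-1.
Proof.
by move=> s0; rewrite /normal_peak -mulrnAr sqrtrM ?sqr_ge0// sqrtr_sqr gtr0_norm.
Qed.

Lemma normal_pdf_affine m s y : 0 < s ->
  normal_pdf m s (m + s * y) * s = normal_pdf 0 1 y.
Proof.
move=> s0; rewrite !normal_pdfE ?gt_eqF// /normal_peak /normal_fun.
rewrite expr1n mul1r subr0 addrAC subrr add0r -mulrnAr sqrtrM ?sqr_ge0//.
rewrite sqrtr_sqr gtr0_norm// invfM.
rewrite (_ : - (s * y) ^+ 2 / (s ^+ 2 *+ 2) = - y ^+ 2 / 2); last first.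
  by field; rewrite gt_eqF.
by field; rewrite !gt_eqF// sqrtr_gt0 mulrn_wgt0// pi_gt0.
Qed.

Lemma ge0_integral_normal_prob_affine m s (h : R -> R) : 0 < s ->
  continuous h -> (forall x, 0 <= h x) ->
  (\int[normal_prob m s]_x (h x)%:E = \int[nu]_y (h (m + s * y))%:E)%E.
Proof.
move=> s0 ch h0.
pose F (y : R^o) := m + s * y.
have cF : continuous F.
  by move=> x; apply: cvgD; [exact: cvg_cst|exact: mulrl_continuous].
have F'E : F^`()%classic = cst s.
  apply/funext => x; rewrite /F derive1E deriveD// derive_cst add0r.
  by rewrite deriveM// derive_cst scaler0 addr0 derive_id scaler1.
rewrite !ge0_integral_normal_prob; last 4 first.
- by apply/measurable_EFinP; apply: continuous_measurable_fun => x; apply: continuous_comp; [exact: cF|exact: ch].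
- by move=> x; rewrite lee_fin.
- by apply/measurable_EFinP; exact: continuous_measurable_fun.
- by move=> x; rewrite lee_fin.
under eq_integral do rewrite -EFinM.
rewrite (@increasing_ge0_integration_by_substitutionT _ F).
- apply: eq_integral => x _; rewrite F'E -EFinM; congr EFin.
  by rewrite -(normal_pdf_affine m x s0) mulrA.
- by move=> x y xy; rewrite ltrD2l ltr_pM2l.
- by rewrite F'E => x; exact: cvg_cst.
- by rewrite F'E; exact: is_cvg_cst.
- by rewrite F'E; exact: is_cvg_cst.
- by move=> x; rewrite /F.
- rewrite /F. under eq_fun do rewrite addrC.
  apply: (@cvg_comp _ _ _ (fun x => s * x) (fun x => x + m)); last exact: cvg_addrr_Ny.
  by apply: gt0_cvgMrNy => //; exact: cvg_id.
- rewrite /F. under eq_fun do rewrite addrC.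
  apply: (@cvg_comp _ _ _ (fun x => s * x) (fun x => x + m)); last exact: cvg_addrr.
  by apply: gt0_cvgMry => //; exact: cvg_id.
- by move=> x; apply: cvgM; [exact: ch|apply: continuous_normal_pdf; rewrite gt_eqF].
- by move=> x; rewrite mulr_ge0// normal_pdf_ge0.
Qed.

(** Completing the square in [z]: the joint density of [z] and [w] splits into the marginal density
    of [w] times the conditional density of [z] given [w]. *)
Lemma normal_pdf_conv s v x w z : 0 < s -> 0 < v ->
  normal_pdf (x + v * z) s w * normal_pdf 0 1 z =
  normal_pdf x (Num.sqrt (s ^+ 2 + v ^+ 2)) w *
  normal_pdf (v * (w - x) / (s ^+ 2 + v ^+ 2)) (s / Num.sqrt (s ^+ 2 + v ^+ 2)) z.
Proof.
move=> s0 v0; have c0 : 0 < s ^+ 2 + v ^+ 2 by rewrite addr_gt0// exprn_gt0.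
set c := Num.sqrt _; have cc : c ^+ 2 = s ^+ 2 + v ^+ 2 by rewrite sqr_sqrtr// ltW.
have cp : 0 < c by rewrite sqrtr_gt0.
rewrite -cc !normal_pdfE ?gt_eqF ?divr_gt0// !normal_peakE ?divr_gt0// /normal_fun.
rewrite expr1n mul1r subr0.
have pi0 : 0 < Num.sqrt (pi *+ 2 : R) by rewrite sqrtr_gt0 mulrn_wgt0// pi_gt0.
rewrite mulrACA [RHS]mulrACA -!expRD; congr (_ * expR _).
  by field; rewrite !gt_eqF.
have s20 : s ^+ 2 != 0 by rewrite gt_eqF// exprn_gt0.
rewrite !expr_div_n cc; field.
by rewrite !gt_eqF.
Qed.

(** Sum of two independent Gaussians. After the substitution [w = x + v * z + s * y], Tonelli puts
    the [z]-integral inside, where [normal_pdf_conv] leaves a conditional density of total mass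
    1. *)
Lemma ge0_normal_conv s v x (h : R -> R) : 0 < s -> 0 < v ->
  continuous h -> (forall x, 0 <= h x) ->
  (\int[nu]_z \int[nu]_y (h (x + v * z + s * y))%:E =
   \int[nu]_y (h (x + Num.sqrt (s ^+ 2 + v ^+ 2) * y))%:E)%E.
Proof.
move=> s0 v0 ch h0; have c0 : 0 < s ^+ 2 + v ^+ 2 by rewrite addr_gt0// exprn_gt0.
have mh := continuous_measurable_fun ch.
pose F (zw : R * R) := ((h zw.2 * normal_pdf (x + v * zw.1) s zw.2)%:E *
    (normal_pdf 0 1 zw.1)%:E)%E.
have mp : measurable_fun [set: R * R]
    (fun zw => h zw.2 * normal_pdf (x + v * zw.1) s zw.2).
  apply: measurable_funM; first exact: measurableT_comp.
  rewrite (_ : (fun _ => _) = (fun zw : R * R =>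
    normal_pdf 0 s (zw.2 - (x + v * zw.1)))); last first.
    apply/funext => zw /=; rewrite !normal_pdfE ?gt_eqF//.
    by rewrite normal_fun_center.
  apply: measurableT_comp; first exact: measurable_normal_pdf.
  apply: measurable_funB => //; apply: measurable_funD => //.
  exact: measurable_funM.
have mF : measurable_fun [set: R * R] F.
  apply: emeasurable_funM; apply/measurable_EFinP; first exact: mp.
  by apply: measurableT_comp => //; exact: measurable_normal_pdf.
have F0 zw : (0 <= F zw)%E.
  by rewrite /F -EFinM lee_fin !mulr_ge0// normal_pdf_ge0.
transitivity (\int[mu]_z \int[mu]_w F (z, w))%E.
  have inner z : (\int[nu]_y (h (x + v * z + s * y))%:E =
      \int[mu]_w (h w * normal_pdf (x + v * z) s w)%:E)%E.
    rewrite -(ge0_integral_normal_prob_affine _ s0 ch h0).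
    rewrite ge0_integral_normal_prob; last 2 first.
    - exact/measurable_EFinP.
    - by move=> y; rewrite lee_fin.
    by apply: eq_integral => w _; rewrite EFinM.
  under eq_integral do rewrite inner.
  rewrite ge0_integral_normal_prob; last 2 first.
  - apply: (@measurable_fun_fubini_tonelli_F _ _ _ _ _ mu
      (fun zw : R * R => (h zw.2 * normal_pdf (x + v * zw.1) s zw.2)%:E)).
    + exact/measurable_EFinP.
    + by move=> zw; rewrite lee_fin mulr_ge0// normal_pdf_ge0.
  - move=> z; apply: integral_ge0 => w _.
    by rewrite lee_fin mulr_ge0// normal_pdf_ge0.
  apply: eq_integral => z _; rewrite -ge0_integralZr; last 4 first.
  - by [].
  - apply/measurable_EFinP; apply: measurable_funM => //.
    exact: measurable_normal_pdf.
  - by move=> w _; rewrite lee_fin mulr_ge0// normal_pdf_ge0.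
  - by rewrite lee_fin normal_pdf_ge0.
  by apply: eq_integral.
rewrite (@fubini_tonelli _ _ _ _ _ mu mu F mF F0).
rewrite -ge0_integral_normal_prob_affine ?sqrtr_gt0//.
rewrite ge0_integral_normal_prob; last 2 first.
- exact/measurable_EFinP.
- by move=> y; rewrite lee_fin.
apply: eq_integral => w _.
under eq_integral => z _.
  rewrite /F /= -EFinM -mulrA normal_pdf_conv// mulrA EFinM.
  over.
rewrite ge0_integralZl//.
- by rewrite integral_normal_pdf mule1 EFinM.
- by apply: measurableT_comp => //; exact: measurable_normal_pdf.
- by move=> z _; rewrite lee_fin normal_pdf_ge0.
- by rewrite lee_fin mulr_ge0// normal_pdf_ge0.
Qed.

(** Exponential tilting: [expR (a * y)] times the standard density is a constant times the density
    with mean [a]. *)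
Lemma normal_mgf a : (\int[nu]_y (expR (a * y))%:E = (expR (a ^+ 2 / 2))%:E)%E.
Proof.
have mexp : measurable_fun [set: R] (fun y => expR (a * y)).
  by apply: measurableT_comp => //; exact: measurable_funM.
rewrite ge0_integral_normal_prob; last 2 first.
- exact/measurable_EFinP.
- by move=> y; rewrite lee_fin expR_ge0.
have pdfE y : expR (a * y) * normal_pdf 0 1 y = expR (a ^+ 2 / 2) * normal_pdf a 1 y.
  rewrite !normal_pdfE ?oner_eq0// mulrCA [RHS]mulrCA; congr (_ * _).
  by rewrite /normal_fun -!expRD; congr expR; field.
under eq_integral do rewrite -EFinM pdfE EFinM.
rewrite ge0_integralZl//.
- by rewrite integral_normal_pdf mule1.
- by apply: measurableT_comp => //; exact: measurable_normal_pdf.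
- by move=> y _; rewrite lee_fin normal_pdf_ge0.
Qed.

Lemma integrable_normal_exp a :
  nu.-integrable [set: R] (EFin \o (fun y => expR (a * y))).
Proof.
apply/integrableP; split.
  apply/measurable_EFinP.
  by apply: measurableT_comp => //; exact: measurable_funM.
under eq_integral do rewrite /= ger0_norm ?expR_ge0//.
by rewrite normal_mgf ltry.
Qed.

(** Integrable majorant, at least 1 and, up to a factor 6, above [|y| ^ 3 * expR |y|]. Bounded
    functions, powers up to 3 and Taylor remainders of the exponential are integrable by comparison
    with it. *)
Definition envelope y : R := expR (2 * y) + expR (- 2 * y).

Lemma integrable_envelope (h : R -> R) C : measurable_fun [set: R] h ->
  (forall y, `|h y| <= C * envelope y) -> nu.-integrable [set: R] (EFin \o h).
Proof.
move=> mh hC.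
apply: (@le_integrable _ _ R nu setT measurableT (EFin \o h) (EFin \o (fun y => C * envelope y))).
- exact/measurable_EFinP.
- by move=> y _ /=; rewrite lee_fin (le_trans (hC y))// ler_norm.
- rewrite (_ : _ \o _ = (fun y => C%:E * (EFin \o envelope) y))%E; last first.
    by apply/funext => y; rewrite /= EFinM.
  apply: integrableZl => //.
  rewrite (_ : _ \o _ = (fun y => (EFin \o (fun y => expR (2 * y))) y +
    (EFin \o (fun y => expR (- 2 * y))) y))%E; last first.
    by apply/funext => y; rewrite /= EFinD.
  by apply: integrableD => //; exact: integrable_normal_exp.
Qed.

Lemma envelope_ge1 y : 1 <= envelope y.
Proof.
rewrite /envelope; have [y0|y0] := leP 0 y.
  by rewrite -[leLHS]addr0 lerD ?expR_ge0// -expR0 ler_expR mulr_ge0.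
rewrite -[leLHS]add0r lerD ?expR_ge0// -expR0 ler_expR.
by rewrite mulNr oppr_ge0 mulr_ge0_le0// ltW.
Qed.

Lemma integrable_bounded (h : R -> R) C : measurable_fun [set: R] h ->
  (forall y, `|h y| <= C) -> nu.-integrable [set: R] (EFin \o h).
Proof.
move=> mh hC; have C0 : 0 <= C by rewrite (le_trans _ (hC 0)).
apply: (integrable_envelope (C := C)) => // y.
by rewrite (le_trans (hC y))// ler_peMr// envelope_ge1.
Qed.

Definition gint (h : R -> R) := nu.-integrable [set: R] (EFin \o h).
Definition gE (h : R -> R) := \int[nu]_y h y.

Lemma gintD h1 h2 : gint h1 -> gint h2 -> gint (fun y => h1 y + h2 y).
Proof. by move=> i1 i2; rewrite /gint; exact: (integrableD measurableT i1 i2). Qed.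

Lemma gintZ c h : gint h -> gint (fun y => c * h y).
Proof. by move=> i; rewrite /gint; exact: (integrableZl measurableT c i). Qed.

Lemma gintB h1 h2 : gint h1 -> gint h2 -> gint (fun y => h1 y - h2 y).
Proof. by move=> i1 i2; rewrite /gint; exact: (integrableB measurableT i1 i2). Qed.

Lemma gint_cst c : gint (fun=> c).
Proof. by apply: (@integrable_bounded _ `|c|). Qed.

Lemma gED h1 h2 : gint h1 -> gint h2 -> gE (fun y => h1 y + h2 y) = gE h1 + gE h2.
Proof. by move=> i1 i2; exact: (RintegralD measurableT i1 i2). Qed.

Lemma gEB h1 h2 : gint h1 -> gint h2 -> gE (fun y => h1 y - h2 y) = gE h1 - gE h2.
Proof. by move=> i1 i2; exact: (RintegralB measurableT i1 i2). Qed.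

Lemma gEZ c h : gint h -> gE (fun y => c * h y) = c * gE h.
Proof. by move=> i; exact: (RintegralZl c measurableT i). Qed.

Lemma gE_cst c : gE (fun=> c) = c.
Proof. by rewrite /gE Rintegral_cst//= /normal_prob integral_normal_pdf mulr1. Qed.

Lemma le_gE h1 h2 : gint h1 -> gint h2 -> (forall y, h1 y <= h2 y) -> gE h1 <= gE h2.
Proof. by move=> i1 i2 h12; exact: (le_Rintegral measurableT i1 i2 (fun y _ => h12 y)). Qed.

Lemma gE_norm_le h1 h2 : gint h1 -> gint h2 -> (forall y, `|h1 y| <= h2 y) ->
  `|gE h1| <= gE h2.
Proof.
move=> i1 i2 h12; rewrite ler_norml; apply/andP; split.
  rewrite -mulN1r -gEZ//; apply: le_gE => //; first exact: gintZ.
  by move=> y; rewrite mulN1r; have := h12 y; rewrite ler_norml => /andP[].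
by apply: le_gE => // y; rewrite (le_trans (ler_norm _)).
Qed.

Lemma cubic_exp_envelope y : `|y| ^+ 3 * expR `|y| <= 6 * envelope y.
Proof.
(* The factor 6 is 3!, from the cubic term of the exponential series. *)
have h3 : `|y| ^+ 3 <= 6 * expR `|y|.
  rewrite mulrC -ler_pdivrMr//.
  by have := @expR_ge1Dxn R `|y| 2 (normr_ge0 y); rewrite !factS fact0; lra.
apply: (@le_trans _ _ (6 * expR (2 * `|y|))).
  rewrite (_ : 2 * `|y| = `|y| + `|y|); last by ring.
  by rewrite expRD mulrA ler_wpM2r ?expR_ge0.
rewrite ler_wpM2l// /envelope; case: ger0P => _.
  by rewrite lerDl expR_ge0.
by rewrite mulrN -mulNr lerDr expR_ge0.
Qed.

End Gaussian.

(** * Taylor estimates, Gaussian moments and Gaussian smoothing of test functions *)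

Section GaussianSmoothing.
Context {R : realType}.
Implicit Types (m s x y v : R).
Local Notation mu := (@lebesgue_measure R).
Local Notation nu := (@normal_prob R 0 1).
Lemma mvt_bound (f df : R -> R) (B u : R) :
  (forall x, is_derive x 1 f (df x)) ->
  (forall c, `|c| <= `|u| -> `|df c| <= B) -> `|f u - f 0| <= B * `|u|.
Proof.
move=> fdf dfB.
have cf : continuous f.
  by move=> x; apply: differentiable_continuous; apply/derivable1_diffP; case: (fdf x).
have [u0|u0] := leP 0 u.
  have [c /itvP c0u ->] := @MVT_segment R f df 0 u u0 (fun x _ => fdf x)
    (continuous_subspaceT cf).
  by rewrite subr0 normrM ler_wpM2r// dfB// !ger0_norm ?c0u.
have [c /itvP c0u] := @MVT_segment R f df u 0 (ltW u0) (fun x _ => fdf x)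
  (continuous_subspaceT cf).
rewrite -normrN opprB => ->; rewrite sub0r normrM normrN ler_wpM2r// dfB//.
by rewrite !ler0_norm ?c0u ?lerN2 ?c0u// ltW.
Qed.

(** The mean value bound is applied three times, to successive Taylor remainders. It does not
    integrate powers of [|c|], which is why the constant is [C] and not [C / 6]. *)
Lemma taylor2_bound (f f1 f2 f3 : R -> R) (C x u : R) :
  (forall x, is_derive x 1 f (f1 x)) -> (forall x, is_derive x 1 f1 (f2 x)) ->
  (forall x, is_derive x 1 f2 (f3 x)) ->
  (forall c, `|c| <= `|u| -> `|f3 (x + c)| <= C) ->
  `|f (x + u) - f x - f1 x * u - f2 x * (u ^+ 2 / 2)| <= C * `|u| ^+ 3.
Proof.
move=> d1 d2 d3 f3C.
have dsh (g dg : R -> R) : (forall x, is_derive x 1 g (dg x)) ->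
    forall c : R, is_derive c 1 (fun c : R => g (x + c)) (dg (x + c)).
  move=> dg1 c.
  have := @is_derive1_comp R g (fun c => x + c) c (dg (x + c)) 1 (dg1 _) _.
  rewrite mulr1; apply. have dx : is_derive c 1 (cst x + id : R -> R) (0 + 1) by exact: is_deriveD.
  by rewrite add0r in dx.
have b2 (c : R) : `|c| <= `|u| -> `|f2 (x + c) - f2 x| <= C * `|c|.
  move=> cu; rewrite -[in f2 x](addr0 x).
  apply: (@mvt_bound (fun c => f2 (x + c)) (fun c => f3 (x + c))).
  by move=> b bc; apply: f3C; exact: le_trans cu.
have C0 : 0 <= C by rewrite (le_trans _ (f3C 0 _))// normr0.
have b1 (c : R) : `|c| <= `|u| -> `|f1 (x + c) - f1 x - f2 x * c| <= C * `|c| ^+ 2.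
  move=> cu; rewrite expr2 mulrA.
  pose g c := f1 (x + c) - f2 x * c.
  rewrite (_ : _ - _ - _ = g c - g 0); last by rewrite /g !addr0 mulr0 subr0 addrAC.
  apply: (@mvt_bound g (fun c => f2 (x + c) - f2 x)).
    move=> b; have := dsh _ _ d2 b => ?; apply: is_derive_eq.
    by rewrite /GRing.scale/= mulr1.
  by move=> b bc; rewrite (le_trans (b2 b (le_trans bc cu)))// ler_wpM2l.
rewrite [_ ^+ 3]exprSr (mulrA C).
pose g c := f (x + c) - f1 x * c - f2 x * (c ^+ 2 / 2).
rewrite (_ : _ - _ = g u - g 0); last by rewrite /g !addr0; ring.
apply: (@mvt_bound g (fun c => f1 (x + c) - f1 x - f2 x * c)).
  move=> b; have := dsh _ _ d1 b => ?; apply: is_derive_eq.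
  by rewrite /GRing.scale/= !mulr1 !mulr0 add0r; field.
move=> b bc; rewrite (le_trans (b1 b bc))// ler_wpM2l// lerXn2r ?nnegrE//.
Qed.

Lemma exp_taylor2 (u : R) :
  `|expR u - 1 - u - u ^+ 2 / 2| <= expR `|u| * `|u| ^+ 3.
Proof.
have := @taylor2_bound (@expR R) (@expR R) (@expR R) (@expR R) (expR `|u|) 0 u.
rewrite add0r expR0 !mul1r; apply => // c cu.
by rewrite add0r ger0_norm ?expR_ge0// ler_expR (le_trans (ler_norm _)).
Qed.

Lemma norm_envelope y (p : nat) : (p <= 3)%N -> `|y ^+ p| <= 6 * envelope y.
Proof.
move=> p3; rewrite normrX; have [y1|y1] := leP `|y| 1.
  apply: (@le_trans _ _ 1); first by rewrite exprn_ile1.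
  by rewrite (le_trans (envelope_ge1 y))// ler_peMl ?(le_trans ler01 (envelope_ge1 y))// ler1n.
rewrite (le_trans _ (cubic_exp_envelope y))//.
apply: (@le_trans _ _ (`|y| ^+ 3)); first by rewrite ler_weXn2l// ltW.
by rewrite ler_peMr ?exprn_ge0// -[leLHS]expR0 ler_expR.
Qed.

Lemma gint_pow (p : nat) : (p <= 3)%N -> gint (fun y : R => y ^+ p).
Proof.
move=> p3; apply: (@integrable_envelope _ _ 6); last by move=> y; exact: norm_envelope.
exact: measurable_funX.
Qed.

Lemma gint_norm3 : gint (fun y : R => `|y| ^+ 3).
Proof.
apply: (@integrable_envelope _ _ 6).
  by apply: (@measurable_funX _ _ _ _ (fun y : R => `|y|)); exact: measurableT_comp.
by move=> y; rewrite normrX normr_id -normrX norm_envelope.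
Qed.

Lemma gE_exp (a : R) : gE (fun y => expR (a * y)) = expR (a ^+ 2 / 2).
Proof. by rewrite /gE /Rintegral normal_mgf. Qed.

Lemma gint_exp (a : R) : gint (fun y => expR (a * y)).
Proof. exact: integrable_normal_exp. Qed.

(* The first two moments are read off the expansion of the moment generating function at 0. *)
Lemma gE_moments : gE (fun y : R => y) = 0 /\ gE (fun y : R => y ^+ 2) = 1.
Proof.
set m1 := gE _; set m2 := gE _.
have i1 : gint (fun y : R => y) by exact: (@gint_pow 1).
have i2 : gint (fun y : R => y ^+ 2) by exact: (@gint_pow 2).
pose D := gE (fun y : R => `|y| ^+ 3 * expR `|y|).
have iD : gint (fun y : R => `|y| ^+ 3 * expR `|y|).
  apply: (@integrable_envelope _ _ 6).
    apply: measurable_funM; last by apply: measurableT_comp => //; exact: measurableT_comp.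
    by apply: (@measurable_funX _ _ _ _ (fun y : R => `|y|)); exact: measurableT_comp.
  by move=> y; rewrite ger0_norm ?cubic_exp_envelope// mulr_ge0 ?expR_ge0 ?exprn_ge0.
have D0 : 0 <= D.
  rewrite -(gE_cst 0); apply: le_gE => //; exact: gint_cst.
(* Both sides of [E exp(a Y) = exp(a^2 / 2)] are expanded to second order in [a]; the two remainders
   are cubic. *)
have key (a : R) : `|a| <= 1 ->
    `|a * m1 + a ^+ 2 * ((m2 - 1) / 2)| <= (D + expR 1) * `|a| ^+ 3.
  move=> a1; set b := a ^+ 2 / 2.
  have hD : `|expR b - 1 - a * m1 - a ^+ 2 / 2 * m2| <= `|a| ^+ 3 * D.
    have -> : expR b - 1 - a * m1 - a ^+ 2 / 2 * m2 =
        gE (fun y => expR (a * y) - 1 - a * y - a ^+ 2 / 2 * y ^+ 2).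
      have j1 : gint (fun y => expR (a * y) - 1).
        by apply: gintB; [exact: gint_exp|exact: gint_cst].
      have j2 : gint (fun y => expR (a * y) - 1 - a * y) by apply: gintB => //; exact: gintZ.
      rewrite (gEB j2 (gintZ _ i2)) (gEB j1 (gintZ _ i1)).
      by rewrite (gEB (gint_exp a) (gint_cst 1)) !gEZ// gE_exp gE_cst.
    rewrite -gEZ//; apply: gE_norm_le; last 1 first.
    - move=> y; have := exp_taylor2 (a * y); rewrite !exprMn mulrAC.
      move=> /le_trans; apply; rewrite normrM exprMn mulrCA ler_wpM2l ?exprn_ge0//.
      by rewrite mulrC ler_wpM2l ?exprn_ge0// ler_expR ler_piMl.
    - apply: gintB; last exact: gintZ.
      apply: gintB; last exact: gintZ.
      by apply: gintB; [exact: gint_exp|exact: gint_cst].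
    - exact: gintZ.
  have b0 : 0 <= b by rewrite divr_ge0 ?sqr_ge0.
  have ab : b = `|a| ^+ 2 / 2 by rewrite real_normK ?num_real.
  have b1 : b <= 1.
    by rewrite ab ler_pdivrMr// mul1r (le_trans (exprn_ile1 _ _ a1))// ler1n.
  have hb : `|expR b - 1 - b| <= expR 1 * `|a| ^+ 3.
    have := exp_taylor2 b; rewrite (ger0_norm b0) => hb.
    have a3 : 0 <= `|a| ^+ 3 by rewrite exprn_ge0.
    have e1 : 2 <= expR 1 :> R by have := expR_ge1Dx (1 : R); lra.
    have hb2 : b ^+ 2 / 2 <= `|a| ^+ 3 / 8.
      rewrite ab.
      rewrite (_ : (`|a| ^+ 2 / 2) ^+ 2 / 2 = `|a| ^+ 3 / 8 * `|a|); last by field.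
      by rewrite ler_piMr// divr_ge0.
    have hb3 : expR b * b ^+ 3 <= expR 1 * (`|a| ^+ 3 / 8).
      rewrite ler_pM ?expR_ge0 ?exprn_ge0 ?ler_expR// ab.
      rewrite (_ : (`|a| ^+ 2 / 2) ^+ 3 = `|a| ^+ 3 / 8 * `|a| ^+ 3); last by field.
      by rewrite ler_piMr ?divr_ge0// exprn_ile1.
    have b20 : 0 <= b ^+ 2 / 2 by rewrite divr_ge0 ?sqr_ge0.
    have : 2 * `|a| ^+ 3 <= expR 1 * `|a| ^+ 3 by rewrite ler_wpM2r.
    by move: hb; rewrite !ler_norml => /andP[]; lra.
  have -> : a * m1 + a ^+ 2 * ((m2 - 1) / 2) =
    (expR b - 1 - b) - (expR b - 1 - a * m1 - a ^+ 2 / 2 * m2) by rewrite /b; field.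
  by rewrite (le_trans (ler_normB _ _))// mulrDl [leRHS]addrC (mulrC D) lerD.
have vanish (q K : R) : (forall e, 0 < e -> e <= 1 -> `|q| <= K * e) -> q = 0.
  move=> h; have [//|q0] := eqVneq q 0.
  have nq : 0 < `|q| by rewrite normr_gt0.
  have K0 : 0 < K by rewrite (lt_le_trans nq)// -(mulr1 K) h.
  pose e := Num.min 1 (`|q| / (2 * K)).
  have e0 : 0 < e by rewrite lt_min ltr01 divr_gt0// mulr_gt0.
  have := h e e0; rewrite ge_min lexx => /(_ isT) qKe.
  have : K * e <= `|q| / 2.
    rewrite (_ : `|q| / 2 = K * (`|q| / (2 * K))); last by field; rewrite gt_eqF.
    by rewrite ler_pM2l// ge_min lexx orbT.
  lra.
(* The bounds at [e] and [- e] together isolate the even coefficient. Once it is known to vanish,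
   the bound at [e] alone gives [m1 = 0]. *)
have h2 (e : R) : 0 < e -> e <= 1 ->
    `|e * m1 + e ^+ 2 * ((m2 - 1) / 2)| <= (D + expR 1) * e ^+ 3 /\
    `|- e * m1 + e ^+ 2 * ((m2 - 1) / 2)| <= (D + expR 1) * e ^+ 3.
  move=> e0 e1; split.
    by have := key e; rewrite gtr0_norm//; apply.
  by have := key (- e); rewrite normrN gtr0_norm// sqrrN; apply.
have q0 : (m2 - 1) / 2 = 0.
  apply: (@vanish _ (D + expR 1)) => e e0 e1; have [ha hb] := h2 e e0 e1.
  have e20 : 0 < e ^+ 2 by rewrite exprn_gt0.
  rewrite -(ler_pM2l e20) -[X in X * `|_|](gtr0_norm e20) -normrM.
  rewrite (_ : _ * (_ * e) = (D + expR 1) * e ^+ 3); last by ring.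
  by move: ha hb; rewrite !ler_norml; lra.
have p0 : m1 = 0.
  apply: (@vanish _ (D + expR 1)) => e e0 e1; have [ha _] := h2 e e0 e1.
  move: ha; rewrite q0 mulr0 addr0 normrM gtr0_norm// => ha.
  rewrite -(ler_pM2l e0); apply: le_trans ha _.
  rewrite (_ : _ * e ^+ 3 = e * ((D + expR 1) * e) * e); last by ring.
  by rewrite ler_piMr// !mulr_ge0 ?addr_ge0 ?expR_ge0 ?(ltW e0).
by split => //; move: q0; lra.
Qed.

(** What the Lindeberg argument asks of a test function, with a single constant [C] for all bounds.
    The third derivative enters only through the Taylor estimate. *)
Record smooth3 (f f1 f2 : R -> R) (C : R) : Prop := Smooth3 {
  smooth3_cont : [/\ continuous f, continuous f1 & continuous f2];
  smooth3_bound : forall x, [/\ `|f x| <= C, `|f1 x| <= C & `|f2 x| <= C];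
  smooth3_lip : forall x u, `|f (x + u) - f x| <= C * `|u|;
  smooth3_taylor : forall x u,
    `|f (x + u) - f x - f1 x * u - f2 x * (u ^+ 2 / 2)| <= C * `|u| ^+ 3 }.

Definition gauss_sm (s : R) (f : R -> R) (x : R) : R := gE (fun y => f (x + s * y)).

Lemma gint_affine (f : R -> R) C (x s : R) : continuous f -> (forall x, `|f x| <= C) ->
  gint (fun y => f (x + s * y)).
Proof.
move=> cf fC; apply: (@integrable_bounded _ _ C) => //.
apply: continuous_measurable_fun => y; apply: continuous_comp; last exact: cf.
by apply: cvgD; [exact: cvg_cst|exact: mulrl_continuous].
Qed.

Lemma gauss_sm_bnd (s : R) (f : R -> R) C x : continuous f -> (forall x, `|f x| <= C) ->
  `|gauss_sm s f x| <= C.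
Proof.
move=> cf fC; rewrite -[leRHS]gE_cst; apply: gE_norm_le => //.
  exact: gint_affine fC.
exact: gint_cst.
Qed.

Lemma gauss_sm_lip (s : R) (f : R -> R) C x u : continuous f -> (forall x, `|f x| <= C) ->
  (forall x u, `|f (x + u) - f x| <= C * `|u|) ->
  `|gauss_sm s f (x + u) - gauss_sm s f x| <= C * `|u|.
Proof.
move=> cf fC lf; have i z := gint_affine z s cf fC.
rewrite -gEB// -[leRHS]gE_cst; apply: gE_norm_le => //.
- exact: gintB.
- exact: gint_cst.
- by move=> y; rewrite addrAC.
Qed.

Lemma lip_continuous (f : R -> R) C : (forall x u, `|f (x + u) - f x| <= C * `|u|) ->
  continuous f.
Proof.
move=> lf x; apply/cvgrPdist_le => /= e e0.
have C0 : 0 <= C by have := le_trans (normr_ge0 _) (lf 0 1); rewrite normr1 mulr1.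
near=> t; have -> : t = x + (t - x) by rewrite addrC subrK.
(* [C + 1] replaces [C] so that dividing by it is legitimate when [C = 0]. *)
rewrite distrC (le_trans (lf _ _))// (@le_trans _ _ ((C + 1) * `|t - x|))//.
  by rewrite ler_wpM2r// lerDl.
rewrite mulrC -ler_pdivlMr ?ltr_wpDl// distrC.
near: t; apply: cvgr_dist_le; first exact: cvg_id.
by rewrite divr_gt0// ltr_wpDl.
Unshelve. all: by end_near. Qed.

Lemma gauss_sm_continuous (s : R) (f : R -> R) C : continuous f -> (forall x, `|f x| <= C) ->
  (forall x u, `|f (x + u) - f x| <= C * `|u|) -> continuous (gauss_sm s f).
Proof. by move=> cf fC lf; apply: (@lip_continuous _ C) => x u; exact: gauss_sm_lip. Qed.

(** Smoothing commutes with translations, so the Taylor bound for [f] is averaged pointwise: the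
    coefficients are the smoothed derivatives and the constant is unchanged, whatever [s] is. *)
Lemma gauss_sm_taylor (s : R) (f f1 f2 : R -> R) C x u : smooth3 f f1 f2 C ->
  `|gauss_sm s f (x + u) - gauss_sm s f x - gauss_sm s f1 x * u
    - gauss_sm s f2 x * (u ^+ 2 / 2)| <= C * `|u| ^+ 3.
Proof.
move=> [[cf cf1 cf2] b l t].
have i z : gint (fun y => f (z + s * y)) by apply: (@gint_affine _ C) => // w; case: (b w).
have i1 z : gint (fun y => f1 (z + s * y)) by apply: (@gint_affine _ C) => // w; case: (b w).
have i2 z : gint (fun y => f2 (z + s * y)) by apply: (@gint_affine _ C) => // w; case: (b w).
rewrite !(mulrC (gauss_sm _ _ _)) -!gEZ// -!gEB//; do ?[exact: gintZ | apply: gintB => //].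
rewrite -[leRHS]gE_cst; apply: gE_norm_le.
- by do ?[exact: gintZ | apply: gintB => //].
- exact: gint_cst.
- by move=> y; rewrite (addrAC x u) (mulrC u) (mulrC (u ^+ 2 / 2)).
Qed.

Lemma gauss_sm_conv (s v : R) (f : R -> R) C x : 0 < s -> 0 < v ->
  continuous f -> (forall x, `|f x| <= C) ->
  (forall x u, `|f (x + u) - f x| <= C * `|u|) ->
  gE (fun z => gauss_sm s f (x + v * z)) = gauss_sm (Num.sqrt (s ^+ 2 + v ^+ 2)) f x.
Proof.
move=> s0 v0 cf fC lf.
have i z t := gint_affine z t cf fC.
have cG := gauss_sm_continuous (s := s) cf fC lf.
have iG := gint_affine x v cG (fun y => gauss_sm_bnd s y cf fC).
(* Adding [C] makes the integrand nonnegative, as Tonelli requires; the constant is cancelled at the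
   end. *)
pose h y := f y + C.
have h0 y : 0 <= h y by have := fC y; rewrite ler_norml /h => /andP[]; lra.
have ch : continuous h by move=> y; apply: cvgD; [exact: cf|exact: cvg_cst].
have hE z t : (\int[nu]_y (h (z + t * y))%:E = (gauss_sm t f z + C)%:E)%E.
  have ih : gint (fun y => h (z + t * y)) by apply: gintD => //; exact: gint_cst.
  have -> : gauss_sm t f z + C = gE (fun y => h (z + t * y)).
    by rewrite /h gED// ?gE_cst//; exact: gint_cst.
  by rewrite /gE /Rintegral fineK//; exact: integrable_fin_num.
have := ge0_normal_conv x s0 v0 ch h0.
rewrite hE; under eq_integral do rewrite hE.
move=> /(congr1 fine) /= H; apply: (addIr C); rewrite -H.
by rewrite -[X in _ + X = _](gE_cst C) -gED//; exact: gint_cst.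
Qed.

(** By [gauss_sm_conv] the wider smoothing averages the narrower one over an independent Gaussian
    shift [v * z]. In the Taylor expansion the linear term has mean 0 and the quadratic one has mean
    [v ^ 2 / 2]. *)
Lemma gauss_sm_step (s v : R) (f f1 f2 : R -> R) C x : smooth3 f f1 f2 C ->
  0 < s -> 0 <= v ->
  `|gauss_sm (Num.sqrt (s ^+ 2 + v ^+ 2)) f x - gauss_sm s f x
    - gauss_sm s f2 x * (v ^+ 2 / 2)| <= C * v ^+ 3 * gE (fun y => `|y| ^+ 3).
Proof.
(* The case [v = 0] is separate because the convolution formula is for positive deviations; it does
   occur, for the very first ball. *)
move=> sm s0; rewrite le_eqVlt => /predU1P[<-|v0].
  rewrite expr0n /= addr0 sqrtr_sqr (gtr0_norm s0) subrr mul0r mulr0 subr0 normr0.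
  by rewrite expr0n/= mulr0 mul0r.
have [[cf cf1 cf2] b l t] := sm.
have fC y : `|f y| <= C by case: (b y).
have [m1 m2] := gE_moments.
have i1 : gint (fun y : R => y) by exact: (@gint_pow 1).
have i2 : gint (fun y : R => y ^+ 2) by exact: (@gint_pow 2).
rewrite -(gauss_sm_conv x s0 v0 cf fC l).
have cG := gauss_sm_continuous (s := s) cf fC l.
have iG := gint_affine x v cG (fun y => gauss_sm_bnd s y cf fC).
set g0 := gauss_sm s f x; set g2 := gauss_sm s f2 x; pose g1 := gauss_sm s f1 x.
have -> : gE (fun z => gauss_sm s f (x + v * z)) - g0 - g2 * (v ^+ 2 / 2) =
   gE (fun z => gauss_sm s f (x + v * z) - g0 - (g1 * v) * z
      - (g2 * (v ^+ 2 / 2)) * z ^+ 2).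
  rewrite !gEB ?gEZ ?gE_cst ?m1 ?m2//; last 5 first.
  - exact: gint_cst.
  - by apply: gintB => //; exact: gint_cst.
  - exact: gintZ.
  - by apply: gintB; [apply: gintB => //; exact: gint_cst|exact: gintZ].
  - exact: gintZ.
  by rewrite mulr0 subr0 mulr1.
rewrite -gEZ; last exact: gint_norm3.
apply: gE_norm_le.
- apply: gintB; last exact: gintZ.
  by apply: gintB; [apply: gintB => //; exact: gint_cst|exact: gintZ].
- by apply: gintZ; exact: gint_norm3.
- move=> z; have := gauss_sm_taylor s x (v * z) sm.
  rewrite -/g0 -/g1 -/g2 normrM (gtr0_norm v0).
  rewrite [X in _ <= X -> _](_ : _ = C * v ^+ 3 * `|z| ^+ 3); last by ring.
  have E1 : g1 * (v * z) = g1 * v * z by ring.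
  have E2 : g2 * ((v * z) ^+ 2 / 2) = g2 * (v ^+ 2 / 2) * z ^+ 2 by field.
  by rewrite E1 E2.
Qed.

End GaussianSmoothing.

(** * Balls in bins: the averaging operator and the collision counts *)

Section Occupancy.
Context {R : realType} {n : nat}.
Implicit Types (d : 'I_n -> nat) (F G : ('I_n -> nat) -> R) (t r : nat).

Definition addball d (j : 'I_n) : 'I_n -> nat := fun i => (d i + (i == j))%N.

Definition throw F : ('I_n -> nat) -> R :=
  fun d => n%:R^-1 * \sum_j F (addball d j).

(* Expectation of [F] over the occupancy numbers of [t] balls thrown independently and
   uniformly into [n] bins. *)
Definition occE t F : R := iter t throw F (fun=> 0%N).

Definition balls d : nat := (\sum_j d j)%N.

Lemma balls_addball d j : balls (addball d j) = (balls d).+1.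
Proof.
rewrite /balls /addball big_split/= -addn1; congr (_ + _)%N.
by rewrite (bigD1 j)//= eqxx big1// => i /negbTE ->.
Qed.

Lemma sum_addball (phi : nat -> R) d j :
  \sum_i phi (addball d j i) = \sum_i phi (d i) + (phi (d j).+1 - phi (d j)).
Proof.
rewrite (bigD1 j)//= [in RHS](bigD1 j)//= /addball eqxx addn1.
rewrite (eq_bigr (fun i => phi (d i))); first by ring.
by move=> i /negbTE ->; rewrite addn0.
Qed.

(** [throw F] is the conditional expectation of [F] given the first [t] balls, so this is the tower
    property for the last ball. Inductions on [t] rest on it. *)
Lemma occES t F : occE t.+1 F = occE t (throw F).
Proof. by rewrite /occE iterSr. Qed.

(** Starting from [d], only occupancies with exactly [t] more balls can be reached, so the
    comparison is needed only there. *)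
Lemma iter_throw_le t F G d : (forall d', balls d' = (balls d + t)%N -> F d' <= G d') ->
  iter t throw F d <= iter t throw G d.
Proof.
elim: t d => [|t IH] d FG; first by apply: FG; rewrite addn0.
rewrite /= /throw ler_wpM2l ?invr_ge0// ler_sum// => j _.
by apply: IH => d' bd'; apply: FG; rewrite bd' balls_addball addSnnS.
Qed.

Lemma occE_le t F G : (forall d, balls d = t -> F d <= G d) -> occE t F <= occE t G.
Proof.
move=> FG; apply: iter_throw_le => d bd; apply: FG.
by rewrite bd /balls big1.
Qed.

Lemma eq_occE t F G : (forall d, balls d = t -> F d = G d) -> occE t F = occE t G.
Proof. by move=> FG; apply/eqP; rewrite eq_le !occE_le// => d bd; rewrite FG. Qed.

Lemma throwD F G d : throw (fun d => F d + G d) d = throw F d + throw G d.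
Proof. by rewrite /throw big_split/= mulrDr. Qed.

Lemma throwZ c F d : throw (fun d => c * F d) d = c * throw F d.
Proof. by rewrite /throw -big_distrr/= mulrCA. Qed.

Lemma iter_throwD t F G d :
  iter t throw (fun d => F d + G d) d = iter t throw F d + iter t throw G d.
Proof.
elim: t d => // t IH d; rewrite !iterS -throwD.
by congr (throw _ d); apply/funext.
Qed.

Lemma iter_throwZ t c F d : iter t throw (fun d => c * F d) d = c * iter t throw F d.
Proof.
elim: t d => // t IH d; rewrite !iterS -throwZ.
by congr (throw _ d); apply/funext.
Qed.

Lemma occED t F G : occE t (fun d => F d + G d) = occE t F + occE t G.
Proof. exact: iter_throwD. Qed.

Lemma occEZ t c F : occE t (fun d => c * F d) = c * occE t F.
Proof. exact: iter_throwZ. Qed.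

Lemma occEB t F G : occE t (fun d => F d - G d) = occE t F - occE t G.
Proof.
rewrite -[in RHS]mulN1r -occEZ -occED.
by apply: eq_occE => d _; rewrite mulN1r.
Qed.

Lemma throw_cst c d : (0 < n)%N -> throw (fun=> c) d = c.
Proof.
move=> n0; rewrite /throw sumr_const card_ord -[c *+ n]mulr_natr mulrCA mulVf ?mulr1//.
by rewrite pnatr_eq0 -lt0n.
Qed.

Lemma occE_cst t c : (0 < n)%N -> occE t (fun=> c) = c.
Proof.
move=> n0; elim: t => // t IH; rewrite occES -[RHS]IH.
by apply: eq_occE => d _; rewrite throw_cst.
Qed.

Lemma occE_norm t F : `|occE t F| <= occE t (fun d => `|F d|).
Proof.
rewrite ler_norml -mulN1r -occEZ !occE_le// => d _; first exact: ler_norm.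
by rewrite mulN1r lerNl -normrN ler_norm.
Qed.

(** Each new ball multiplies the mean by [1 + (a - 1) / n], since it hits a given bin with
    probability [1 / n]. With [t] at most [k * n] this bounds exponential moments of the bin sizes
    uniformly in [n]. *)
Lemma occE_sum_exp t (a : R) : (0 < n)%N ->
  occE t (fun d => \sum_j a ^+ d j) = n%:R * (1 + (a - 1) / n%:R) ^+ t.
Proof.
move=> n0; elim: t => [|t IH].
  by rewrite expr0 mulr1 /occE /= sumr_const card_ord.
rewrite occES exprS mulrCA -IH -occEZ; apply: eq_occE => d _.
rewrite /throw; under eq_bigr do rewrite (sum_addball (fun m => a ^+ m)).
rewrite big_split/= sumr_const card_ord.
under [X in _ + X]eq_bigr do rewrite exprS -[X in _ - X]mul1r -mulrBl.
rewrite -big_distrr/= -[_ *+ n]mulr_natr; field.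
by rewrite pnatr_eq0 -lt0n.
Qed.

Lemma one_plus_exp (x : R) t : 0 <= x -> (1 + x / n%:R) ^+ t <= expR (x * t%:R / n%:R).
Proof.
move=> x0; rewrite mulrAC expRM_natr lerXn2r ?nnegrE ?expR_ge0 ?expR_ge1Dx//.
by rewrite addr_ge0// divr_ge0.
Qed.

Lemma occE_sum_exp_le t k (a : R) : (0 < n)%N -> 1 <= a -> (t <= k * n)%N ->
  occE t (fun d => \sum_j a ^+ d j) <= n%:R * expR ((a - 1) * k%:R).
Proof.
move=> n0 a1 tkn; rewrite occE_sum_exp// ler_wpM2l//.
rewrite (le_trans (one_plus_exp _ _)) ?subr_ge0// ler_expR -mulrA ler_wpM2l ?subr_ge0//.
by rewrite ler_pdivrMr ?ltr0n// -natrM ler_nat.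
Qed.

(* [abin r t] is the mean of the number [Abin r] of [r]-fold collisions among [t] balls. *)
Definition Abin r d : R := \sum_j 'C(d j, r)%:R.
Definition abin r t : R := 'C(t, r)%:R / n%:R ^+ r * n%:R.
Definition Wbin r t d : R := Abin r d - abin r t.

(** By Pascal's rule a ball falling into a bin of [m] balls creates ['C(m, r)] new collisions of
    order [r + 1]. Averaged over [j], the drift is [Wbin r t d / n]; for [r = 1] it vanishes since
    [t] balls are present, which makes [Wbin 2] a martingale. *)
Lemma WbinS r t d j : (0 < n)%N ->
  Wbin r.+1 t.+1 (addball d j) = Wbin r.+1 t d + ('C(d j, r)%:R - abin r t / n%:R).
Proof.
move=> n0; rewrite /Wbin /Abin (sum_addball (fun m => 'C(m, r.+1)%:R)) binS natrD.
have nz : (n%:R : R) != 0 by rewrite pnatr_eq0 -lt0n.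
by rewrite /abin binS natrD exprS; field; rewrite ?nz ?expf_neq0.
Qed.

Lemma bin_le_exp2 (m r : nat) : ('C(m, r) <= 2 ^ m)%N.
Proof.
elim: m r => [|m IH] [|r] //; first by rewrite bin0 expn_gt0.
by rewrite binS expnS mul2n -addnn leq_add.
Qed.

Lemma bin_le_pow (m r : nat) : ('C(m, r) <= m ^ r)%N.
Proof.
elim: r m => [|r IH] [|m] //; rewrite ?bin0 ?bin0n//.
have := mul_bin_diag m.+1 r; rewrite /= => H.
rewrite expnS (leq_trans _ (leq_mul (leqnn m.+1) (leq_trans (IH m) _)))//.
  by rewrite H leq_pmull.
by case: r {IH H} => // r; rewrite leq_exp2r.
Qed.
Lemma bin2R (m : nat) : 2 * 'C(m, 2)%:R = m%:R ^+ 2 - m%:R :> R.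
Proof.
elim: m => [|m IH]; first by rewrite bin0n mulr0 expr0n subrr.
by rewrite binS bin1 natrD mulrDr IH -natr1; ring.
Qed.

End Occupancy.

(** * Concentration of the collision counts *)

Section Moments.
Context {R : realType}.

Lemma Wbin0 n t (d : 'I_n -> nat) : Wbin 0 t d = 0 :> R.
Proof.
rewrite /Wbin /Abin /abin; under eq_bigr do rewrite bin0.
by rewrite sumr_const card_ord bin0 expr0 divr1 mul1r subrr.
Qed.

Lemma abin_bound n r t k : (0 < n)%N -> (t <= k * n)%N ->
  0 <= @abin R n r t / n%:R <= k%:R ^+ r.
Proof.
move=> n0 tkn; have nz : (n%:R : R) != 0 by rewrite pnatr_eq0 -lt0n.
rewrite /abin mulfK// divr_ge0 ?exprn_ge0//=.
rewrite ler_pdivrMr ?exprn_gt0 ?ltr0n// -exprMn -natrM -natrX ler_nat.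
rewrite (leq_trans (bin_le_pow _ _))//.
by case: r => // r; rewrite leq_exp2r.
Qed.

(** Induction on [r]: the drift of [Wbin r.+1] is [Wbin r / n], whose second moment is known, and
    the squared jumps have bounded mean. A discrete Gronwall argument over at most [k * n] balls
    then gives growth linear in [n]. *)
Lemma Wbin_moment k r : exists2 c : R, 0 <= c & forall n t, (0 < n)%N -> (t <= k * n)%N ->
  occE t (fun d : 'I_n -> nat => Wbin r t d ^+ 2) <= c * n%:R.
Proof.
elim: r => [|r [c c0 IH]].
  exists 0 => // n t n0 tkn; rewrite mul0r.
  rewrite (@eq_occE _ _ _ _ (fun=> 0)) ?occE_cst// => d _.
  by rewrite Wbin0 expr0n.
(* [D] bounds the additive gain per ball: [c] comes from the drift, the exponential from squared
   binomials bounded by [4 ^ d j], the last term from the squared mean jump. *)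
pose D : R := c + 2 * expR (3 * k%:R) + 2 * (k%:R ^+ r) ^+ 2.
have D0 : 0 <= D by rewrite !addr_ge0 ?mulr_ge0 ?expR_ge0 ?sqr_ge0.
exists (k%:R * D * expR k%:R); first by rewrite !mulr_ge0 ?expR_ge0.
move=> n t n0 tkn; have nz : (n%:R : R) != 0 by rewrite pnatr_eq0 -lt0n.
have np : (0 : R) < n%:R by rewrite ltr0n.
(* The inner induction on [t] needs this sharper bound, with a factor [1 + 1 / n] per ball, which
   stays below [expR k] in total. *)
apply: (@le_trans _ _ (t%:R * D * (1 + 1 / n%:R) ^+ t)); last first.
  rewrite (mulrAC _ (expR _)) ler_pM ?mulr_ge0 ?exprn_ge0 ?addr_ge0 ?divr_ge0//.
    by rewrite mulrAC ler_wpM2r// -natrM ler_nat.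
  rewrite (le_trans (one_plus_exp _ _))// mul1r ler_expR ler_pdivrMr//.
  by rewrite -natrM ler_nat.
elim: t tkn => [|t IHt] tkn.
  by rewrite mul0r mul0r /occE/= /Wbin /Abin /abin big1// bin0n !mul0r subr0 expr0n.
have tkn' : (t <= k * n)%N by rewrite ltnW.
have /andP[ar0 ark] := abin_bound r n0 tkn'.
rewrite occES.
apply: (@le_trans _ _ (occE t (fun d : 'I_n -> nat =>
   (1 + 1 / n%:R) * Wbin r.+1 t d ^+ 2 + (n%:R^-1 * Wbin r t d ^+ 2 +
    (2 / n%:R * \sum_j 4 ^+ d j + 2 * (k%:R ^+ r) ^+ 2))))).
  apply: occE_le => d _.
  pose w := Wbin r.+1 t d : R; pose del (j : 'I_n) : R := 'C(d j, r)%:R - @abin R n r t / n%:R.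
  have sdel : \sum_j del j = Wbin r t d.
    rewrite /del big_split/= sumr_const card_ord -[_ *+ n]mulr_natr mulNr divfK//.
  have -> : throw (fun d => Wbin r.+1 t.+1 d ^+ 2) d =
      w ^+ 2 + 2 * w * (n%:R^-1 * Wbin r t d) + n%:R^-1 * \sum_j del j ^+ 2.
    have E j : Wbin r.+1 t.+1 (addball d j) ^+ 2 = w ^+ 2 + 2 * w * del j + del j ^+ 2.
      by rewrite WbinS// -/w -/(del j); ring.
    rewrite /throw; under eq_bigr do rewrite E.
    rewrite !big_split/= sumr_const card_ord -[_ *+ n]mulr_natr -sdel -big_distrr/=.
    by field.
  have hd : n%:R^-1 * \sum_j del j ^+ 2 <=
      2 / n%:R * \sum_j 4 ^+ d j + 2 * (k%:R ^+ r) ^+ 2.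
    apply: (@le_trans _ _ (n%:R^-1 * \sum_j (2 * 4 ^+ d j + 2 * (k%:R ^+ r) ^+ 2))).
      rewrite ler_wpM2l ?invr_ge0// ler_sum// => j _.
      have cd : ('C(d j, r)%:R : R) ^+ 2 <= 4 ^+ d j.
        rewrite -natrX -[4]/(4%:R) -natrX ler_nat (_ : 4 = 2 ^ 2)%N// -expnM mulnC expnM.
        rewrite leq_exp2r//.
        exact: bin_le_exp2.
      have ca : (@abin R n r t / n%:R) ^+ 2 <= (k%:R ^+ r) ^+ 2 :> R.
        by rewrite lerXn2r ?nnegrE ?exprn_ge0.
      have := sqr_ge0 ('C(d j, r)%:R + @abin R n r t / n%:R : R).
      by rewrite /del sqrrD sqrrB; lra.
    rewrite big_split/= sumr_const card_ord -[_ *+ n]mulr_natr -big_distrr/=.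
    by rewrite le_eqVlt; apply/orP; left; apply/eqP; field.
  (* The cross term is split by [2 a b <= a ^ 2 + b ^ 2]; the part in [w ^ 2] is the source of the
     factor [1 + 1 / n]. *)
  have h2 : 2 * w * (n%:R^-1 * Wbin r t d) <= n%:R^-1 * w ^+ 2 + n%:R^-1 * Wbin r t d ^+ 2.
    rewrite mulrCA -mulrDr ler_wpM2l ?invr_ge0//.
    by have := sqr_ge0 (w - Wbin r t d); rewrite sqrrB; lra.
  rewrite -/w mulrDl !mul1r; lra.
rewrite !occED !occEZ occE_cst//.
have h1 := IHt tkn'; have h2 := IH n t n0 tkn'.
have h3 := @occE_sum_exp_le R n t k 4 n0 _ tkn'.
apply: (@le_trans _ _ ((1 + 1 / n%:R) * (t%:R * D * (1 + 1 / n%:R) ^+ t) + D)).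
  apply: lerD; first by rewrite ler_wpM2l// addr_ge0 ?divr_ge0.
  rewrite /D -addrA; apply: lerD; first by rewrite ler_pdivrMl// mulrC.
  rewrite lerD2r -mulrA ler_wpM2l// ler_pdivrMl//.
  rewrite (_ : 3 = 4 - 1 :> R); last by ring.
  by apply: h3; lra.
have -> : t.+1%:R * D * (1 + 1 / n%:R) ^+ t.+1 =
  (1 + 1 / n%:R) * (t%:R * D * (1 + 1 / n%:R) ^+ t) + D * (1 + 1 / n%:R) ^+ t.+1.
  by rewrite exprS -natr1; ring.
rewrite lerD2l ler_peMr// exprn_ege1// lerDl divr_ge0//.
Qed.

Lemma Wbin_moment1 k r : exists2 c : R, 0 <= c & forall n t, (0 < n)%N -> (t <= k * n)%N ->
  occE t (fun d : 'I_n -> nat => `|Wbin r t d|) <= c * Num.sqrt n%:R.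
Proof.
have [c c0 H] := Wbin_moment k r; exists ((c + 1) / 2); first by rewrite divr_ge0 ?addr_ge0.
move=> n t n0 tkn; set q := Num.sqrt _.
have q0 : 0 < q by rewrite sqrtr_gt0 ltr0n.
have qq : q ^+ 2 = n%:R by rewrite sqr_sqrtr.
(* Instead of Cauchy-Schwarz: [|w| <= w ^ 2 / (2 q) + q / 2] with the optimal scale [q = sqrt n]. *)
apply: (@le_trans _ _ (occE t (fun d : 'I_n -> nat => (2 * q)^-1 * Wbin r t d ^+ 2 + q / 2))).
  apply: occE_le => d _; set w := Wbin _ _ _.
  rewrite -(ler_pM2l (_ : 0 < 2 * q)) ?mulr_gt0//.
  rewrite (_ : _ * (_ + _) = w ^+ 2 + q ^+ 2); last by field; rewrite gt_eqF.
  rewrite -(real_normK (num_real w)).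
  by have := sqr_ge0 (`|w| - q); rewrite sqrrB; lra.
rewrite occED occEZ occE_cst//.
apply: (@le_trans _ _ ((2 * q)^-1 * (c * n%:R) + q / 2)).
  by rewrite lerD2r ler_wpM2l ?invr_ge0 ?mulr_ge0 ?(ltW q0)// H.
by rewrite -qq le_eqVlt; apply/orP; left; apply/eqP; field; rewrite gt_eqF.
Qed.

End Moments.

Ltac nneg := by do ?[apply: mulr_ge0 | apply: exprn_ge0 | rewrite invr_ge0 | apply: addr_ge0 | apply: expR_ge0].

(** * Lindeberg replacement for the normalised collision count *)

Section Lindeberg.
Context {R : realType} (k : nat) (beta : R).
Hypotheses (k0 : (0 < k)%N) (beta0 : 0 < beta).
Variables (f f1 f2 : R -> R) (C : R).
Hypothesis sm : smooth3 f f1 f2 C.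

Lemma C_ge0 : 0 <= C.
Proof. by case: (smooth3_bound sm 0) => + _ _; exact: le_trans. Qed.

Lemma taylor_average n (u : 'I_n -> R) s x : (0 < n)%N -> \sum_j u j = 0 ->
  `|n%:R^-1 * (\sum_j gauss_sm s f (x + u j)) - gauss_sm s f x
    - gauss_sm s f2 x * (n%:R^-1 * (\sum_j u j ^+ 2) / 2)|
  <= C * (n%:R^-1 * \sum_j `|u j| ^+ 3).
Proof.
move=> n0 u0; have nz : (n%:R : R) != 0 by rewrite pnatr_eq0 -lt0n.
set g := gauss_sm s f; set g2 := gauss_sm s f2 x; pose g1 := gauss_sm s f1 x.
have -> : n%:R^-1 * (\sum_j g (x + u j)) - g x - g2 * (n%:R^-1 * (\sum_j u j ^+ 2) / 2) =
   n%:R^-1 * \sum_j (g (x + u j) - g x - g1 * u j - g2 * (u j ^+ 2 / 2)).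
  rewrite !sumrB sumr_const card_ord -[_ *+ n]mulr_natr -!big_distrr/= u0 mulr0 -big_distrl/=.
  by field.
rewrite normrM ger0_norm ?invr_ge0// mulrCA ler_wpM2l ?invr_ge0// big_distrr/=.
rewrite (le_trans (ler_norm_sum _ _ _))// ler_sum// => j _.
exact: gauss_sm_taylor.
Qed.

(** The statistic [S = (E A_2 - A_2) / alpha], with [alpha = beta sqrt n]. *)
Definition centred n t (d : 'I_n -> nat) : R := - Wbin 2 t d / (beta * Num.sqrt n%:R).

(** Limiting variance minus the variances [i / (beta^2 n^2)], for [i < t], already spent by the
    first [t] balls. At [t = k * n] a positive amount [k / (2 beta^2 n)] is left over, so the
    smoothing never degenerates. *)
Definition remvar n t : R :=
  k%:R ^+ 2 / (2 * beta ^+ 2) - t%:R * (t%:R - 1) / (2 * beta ^+ 2 * n%:R ^+ 2).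

Lemma remvar_gt0 n t : (0 < n)%N -> (t <= k * n)%N -> 0 < remvar n t.
Proof.
move=> n0 tkn; have np : (0 : R) < n%:R by rewrite ltr0n.
have kp : (0 : R) < k%:R by rewrite ltr0n.
have b2 : 0 < beta ^+ 2 by rewrite exprn_gt0.
have -> : remvar n t = ((k%:R * n%:R) ^+ 2 - t%:R * (t%:R - 1)) / (2 * beta ^+ 2 * n%:R ^+ 2).
  by rewrite /remvar; field; rewrite !gt_eqF.
rewrite divr_gt0 ?mulr_gt0 ?exprn_gt0// subr_gt0.
have tk : (t%:R : R) <= k%:R * n%:R by rewrite -natrM ler_nat.
have knp : 0 < k%:R * n%:R :> R by rewrite mulr_gt0.
have [t1|t1] := leP (t%:R : R) 1.
  rewrite (@le_lt_trans _ _ 0) ?exprn_gt0//.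
  by rewrite mulr_ge0_le0 ?subr_le0.
apply: (@lt_le_trans _ _ (t%:R * t%:R)); first by rewrite ltr_pM2l; lra.
by rewrite expr2 ler_pM.
Qed.

Lemma remvarS n t : (0 < n)%N ->
  remvar n t = remvar n t.+1 + (Num.sqrt t%:R / (beta * n%:R)) ^+ 2.
Proof.
move=> n0; have nz : (n%:R : R) != 0 by rewrite pnatr_eq0 -lt0n.
rewrite expr_div_n sqr_sqrtr// /remvar -natr1; field.
by rewrite nz gt_eqF.
Qed.

(* [t] balls are thrown and the remaining increments are replaced by Gaussian ones. *)
Definition interp n x0 t (d : 'I_n -> nat) : R :=
  gauss_sm (Num.sqrt (remvar n t)) f (x0 + centred t d).

Lemma sum_centred_counts n t (d : 'I_n -> nat) : (0 < n)%N -> balls d = t ->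
  \sum_j ((d j)%:R - t%:R / n%:R) = 0 :> R.
Proof.
move=> n0 bd; rewrite sumrB sumr_const card_ord -[_ *+ n]mulr_natr divfK ?pnatr_eq0 -?lt0n//.
by rewrite -bd /balls natr_sum subrr.
Qed.

(** Up to scaling, the first term is the conditional variance of the next increment. It differs from
    the deterministic [t / n] by a multiple of [Wbin 2] and a small term, so concentration of [A_2]
    makes conditional variances asymptotically deterministic. *)
Lemma mean_sqr_centred_counts n t (d : 'I_n -> nat) : (0 < n)%N -> balls d = t ->
  n%:R^-1 * \sum_j ((d j)%:R - t%:R / n%:R) ^+ 2 - t%:R / n%:R
    = (2 * Wbin 2 t d - t%:R / n%:R) / n%:R :> R.
Proof.
move=> n0 bd; have nz : (n%:R : R) != 0 by rewrite pnatr_eq0 -lt0n.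
have sd : \sum_j (d j)%:R = t%:R :> R by rewrite -bd /balls natr_sum.
have -> : Wbin 2 t d = ((\sum_j (d j)%:R ^+ 2) - t%:R) / 2 - (t%:R ^+ 2 - t%:R) / 2 / n%:R :> R.
  rewrite /Wbin /Abin /abin -bin2R -sd -sumrB.
  congr (_ - _); last by field.
  by rewrite big_distrl/=; apply: eq_bigr => j _; rewrite -bin2R; field.
have -> : \sum_j ((d j)%:R - t%:R / n%:R) ^+ 2 = \sum_j (d j)%:R ^+ 2 - t%:R ^+ 2 / n%:R :> R.
  under eq_bigr do rewrite sqrrB.
  rewrite big_split/= sumrB sumr_const card_ord -[_ *+ n]mulr_natr.
  under [X in _ - X + _]eq_bigr do rewrite -mulr_natr mulrAC.
  rewrite -!big_distrl/= sd; by field.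
by field.
Qed.

(** One exchange of a ball increment for a Gaussian one. First-order terms vanish on both sides,
    second-order terms differ by the error in the conditional variance, and the rest is cubic;
    everything is of order [n ^ (- 3 / 2)], which can be summed over [k * n] balls. *)
Lemma interp_step : exists K : R, forall n x0 t, (0 < n)%N -> (t < k * n)%N ->
  `|occE t.+1 (interp (n := n) x0 t.+1) - occE t (interp (n := n) x0 t)|
     <= K * (Num.sqrt n%:R)^-1 ^+ 3.
Proof.
have [c2 c20 H2] := @Wbin_moment1 R k 2.
pose M := gE (fun y : R => `|y| ^+ 3).
have C0 := C_ge0; have B' := ltW beta0.
have M0 : 0 <= M.
  by rewrite -(gE_cst 0); apply: le_gE => //; [exact: gint_cst|exact: gint_norm3].
(* [K1] pays for the cubic remainder of the ball increment, [K2] for the mismatch of variances, [K3]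
   for the cubic remainder of the Gaussian increment. *)
pose K1 : R := C * (((k%:R + 1) / beta) ^+ 3 * expR (7 * k%:R)).
pose K2 : R := C / 2 * ((2 * c2 + k%:R) / beta ^+ 2).
pose K3 : R := C * (Num.sqrt k%:R / beta) ^+ 3 * M.
exists (K1 + K2 + K3) => n x0 t n0 tkn.
have tkn' : (t <= k * n)%N by rewrite ltnW.
have nz : (n%:R : R) != 0 by rewrite pnatr_eq0 -lt0n.
have np : (0 : R) < n%:R by rewrite ltr0n.
set q := (Num.sqrt _)^-1.
have q0 : 0 < q by rewrite invr_gt0 sqrtr_gt0.
have Q' := ltW q0.
have qq : q ^+ 2 = n%:R^-1 by rewrite /q exprVn sqr_sqrtr.
have q1 : q <= 1.
  by rewrite -(@expr_le1 _ 2)// ?(ltW q0)// qq invf_le1// ler1n.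
have sq : Num.sqrt n%:R = q^-1 :> R by rewrite /q invrK.
set v := Num.sqrt t%:R / (beta * n%:R).
have v0 : 0 <= v by rewrite divr_ge0// mulr_ge0// ltW.
set s := Num.sqrt (remvar n t.+1).
have s0 : 0 < s by rewrite sqrtr_gt0 remvar_gt0.
have sv : Num.sqrt (remvar n t) = Num.sqrt (s ^+ 2 + v ^+ 2).
  by rewrite (remvarS _ n0) sqr_sqrtr// ltW// remvar_gt0.
have vq : v <= Num.sqrt k%:R / beta * q.
  rewrite /v invfM -qq.
  rewrite (_ : Num.sqrt k%:R / beta * q = Num.sqrt k%:R / q * (beta^-1 * q ^+ 2)); last first.
    by field; rewrite !gt_eqF.
  rewrite ler_wpM2r ?mulr_ge0 ?invr_ge0 ?exprn_ge0 ?(ltW beta0) ?(ltW q0)//.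
  by rewrite -sq -sqrtrM// ler_sqrt -?natrM// ler_nat.
rewrite occES -occEB (le_trans (occE_norm _ _))//.
apply: (@le_trans _ _ (occE t (fun d : 'I_n -> nat =>
   C * (((k%:R + 1) / beta) ^+ 3 * q ^+ 3) * (n%:R^-1 * \sum_j 8 ^+ d j)
   + (C / 2 * (q ^+ 4 / beta ^+ 2) * (2 * `|Wbin 2 t d|)
   + (C / 2 * (q ^+ 4 / beta ^+ 2) * k%:R + K3 * q ^+ 3))))); last first.
  rewrite !occED !occE_cst// !occEZ.
  have h8 : n%:R^-1 * occE t (fun d : 'I_n -> nat => \sum_j 8 ^+ d j) <= expR (7 * k%:R) :> R.
    rewrite ler_pdivrMl// (_ : 7 = 8 - 1 :> R); last by ring.
    by apply: occE_sum_exp_le => //; lra.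
  have hW := H2 n t n0 tkn'; rewrite sq in hW.
  have hA : C * (((k%:R + 1) / beta) ^+ 3 * q ^+ 3) *
     (n%:R^-1 * occE t (fun d : 'I_n -> nat => \sum_j 8 ^+ d j)) <= K1 * q ^+ 3.
    rewrite (_ : K1 * _ =
      C * (((k%:R + 1) / beta) ^+ 3 * q ^+ 3) * expR (7 * k%:R)).
      by rewrite ler_wpM2l//; nneg.
    by rewrite /K1; ring.
  pose B := C / 2 * (q ^+ 3 / beta ^+ 2).
  have B0 : 0 <= B by nneg.
  have qB : C / 2 * (q ^+ 4 / beta ^+ 2) = B * q by rewrite /B; ring.
  have hB : B * q * (2 * occE t (fun d : 'I_n -> nat => `|Wbin 2 t d|)) <= B * (2 * c2).
    rewrite -mulrA ler_wpM2l// mulrCA ler_wpM2l//.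
    by rewrite -[leRHS](mulfVK (lt0r_neq0 q0)) mulrC ler_wpM2r ?(ltW q0).
  have hk : B * q * k%:R <= B * k%:R.
    by rewrite ler_wpM2r// ler_piMr.
  rewrite qB (_ : (K1 + K2 + K3) * q ^+ 3 =
    K1 * q ^+ 3 + (B * (2 * c2) + (B * k%:R + K3 * q ^+ 3))).
    by rewrite lerD// lerD// lerD2r.
  by rewrite /K2 /B; field; rewrite gt_eqF.
apply: occE_le => d bd.
(* [u j] is the change of [centred] when the next ball falls into bin [j]. *)
pose u (j : 'I_n) : R := - ((d j)%:R - t%:R / n%:R) * (q / beta).
have su : \sum_j u j = 0 by rewrite -big_distrl/= sumrN sum_centred_counts// oppr0 mul0r.
have thE : throw (interp x0 t.+1) d =
    n%:R^-1 * \sum_j gauss_sm s f (x0 + centred t d + u j).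
  rewrite /throw /interp; congr (_ * _); apply: eq_bigr => j _; congr gauss_sm.
  rewrite /centred WbinS// sq bin1 /abin bin1 expr1 /u; field.
  by rewrite nz !gt_eqF.
rewrite thE {1}/interp sv; set x := x0 + _.
have T1 := taylor_average s x n0 su.
have T2 := gauss_sm_step x sm s0 v0.
have su2 : n%:R^-1 * (\sum_j u j ^+ 2) - v ^+ 2 =
    (q ^+ 4 / beta ^+ 2) * (2 * Wbin 2 t d - t%:R / n%:R).
  have -> : \sum_j u j ^+ 2 = q ^+ 2 / beta ^+ 2 * \sum_j ((d j)%:R - t%:R / n%:R) ^+ 2.
    rewrite big_distrr/=; apply: eq_bigr => j _; rewrite /u; field.
    by rewrite nz gt_eqF.
  rewrite mulrCA; have := @mean_sqr_centred_counts n t d n0 bd => /(congr1 (fun z => z + t%:R / n%:R)).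
  rewrite subrK => ->; rewrite /v expr_div_n sqr_sqrtr//.
  have -> : q ^+ 4 = n%:R^-1 * n%:R^-1 by rewrite -qq; ring.
  rewrite qq.
  by field; rewrite nz gt_eqF.
have tnk : t%:R / n%:R <= k%:R :> R by rewrite ler_pdivrMr// -natrM ler_nat.
have tn0 : 0 <= t%:R / n%:R :> R by rewrite divr_ge0.
have su3 : n%:R^-1 * (\sum_j `|u j| ^+ 3) <=
    ((k%:R + 1) / beta) ^+ 3 * q ^+ 3 * (n%:R^-1 * \sum_j 8 ^+ d j).
  rewrite mulrCA ler_wpM2l ?invr_ge0// big_distrr/= ler_sum// => j _.
  (* Bounding [d j] by [2 ^ d j] turns the third absolute moment into the mean of [8 ^ d j], which
     [occE_sum_exp_le] controls. *)
  have dle : `|(d j)%:R - t%:R / n%:R| <= (k%:R + 1) * 2 ^+ d j :> R.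
    have d2 : (d j)%:R <= 2 ^+ d j :> R.
      by rewrite -[2]/(2%:R) -natrX ler_nat ltnW// ltn_expl.
    have p1 : 1 <= 2 ^+ d j :> R by rewrite exprn_ege1// ler1n.
    have kk : k%:R <= k%:R * 2 ^+ d j :> R by rewrite ler_peMr.
    have d0 : 0 <= (d j)%:R :> R by [].
    by rewrite ler_norml mulrDl mul1r; apply/andP; split; lra.
  rewrite /u normrM normrN (ger0_norm (_ : 0 <= q / beta)) ?divr_ge0 ?(ltW q0) ?(ltW beta0)//.
  rewrite (_ : 8 = 2 ^+ 3 :> R); last by ring.
  rewrite -exprM mulnC exprM exprMn.
  rewrite (_ : ((k%:R + 1) / beta) ^+ 3 * q ^+ 3 * _ =
    ((k%:R + 1) * 2 ^+ d j) ^+ 3 * (q / beta) ^+ 3); last by field; rewrite gt_eqF.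
  by apply: ler_wpM2r; [nneg | rewrite lerXn2r// nnegrE; nneg].
have g2C : `|gauss_sm s f2 x| <= C.
  by apply: gauss_sm_bnd; [case: (smooth3_cont sm)|move=> y; case: (smooth3_bound sm y)].
set g := gauss_sm s f in T1 T2 *; set g2 := gauss_sm s f2 x in T1 T2 g2C *.
set a := n%:R^-1 * \sum_j u j ^+ 2 in T1 su2.
have -> : n%:R^-1 * (\sum_j g (x + u j)) - gauss_sm (Num.sqrt (s ^+ 2 + v ^+ 2)) f x =
  (n%:R^-1 * (\sum_j g (x + u j)) - g x - g2 * (a / 2)) + g2 * (a - v ^+ 2) / 2
   - (gauss_sm (Num.sqrt (s ^+ 2 + v ^+ 2)) f x - g x - g2 * (v ^+ 2 / 2)) by field.
rewrite (le_trans (ler_normB _ _))// addrA addrA.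
apply: lerD; last first.
  apply: (le_trans T2).
  rewrite (_ : K3 * q ^+ 3 = C * (Num.sqrt k%:R / beta * q) ^+ 3 * M); last first.
    by rewrite /K3; ring.
  apply: ler_wpM2r => //; apply: ler_wpM2l => //.
  by rewrite lerXn2r// nnegrE; nneg.
rewrite (le_trans (ler_normD _ _))// -addrA; apply: lerD.
  apply: (le_trans T1); rewrite -mulrA ler_wpM2l//.
have hX : `|a - v ^+ 2| <= q ^+ 4 / beta ^+ 2 * (2 * `|Wbin 2 t d| + k%:R).
  have Z : 0 <= q ^+ 4 / beta ^+ 2 by nneg.
  rewrite su2 normrM (ger0_norm Z) ler_wpM2l// (le_trans (ler_normB _ _))//.
  by rewrite normrM (ger0_norm tn0) ger0_norm// lerD2l.
rewrite normrM normfV normrM (ger0_norm (_ : 0 <= 2 :> R))//.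
apply: (@le_trans _ _ (C * (q ^+ 4 / beta ^+ 2 * (2 * `|Wbin 2 t d| + k%:R)) / 2)).
  by rewrite ler_wpM2r ?invr_ge0// ler_pM.
by rewrite le_eqVlt; apply/orP; left; apply/eqP; field; rewrite gt_eqF.
Qed.

(** The exchanges telescope: [k * n] steps of size [K * n ^ (- 3 / 2)] lead from the pure Gaussian
    at [t = 0] to the statistic of all balls. *)
Lemma lindeberg : exists K : R, forall n x0, (0 < n)%N ->
  `|occE (k * n) (fun d : 'I_n -> nat => f (x0 + centred (k * n) d))
    - gauss_sm (Num.sqrt (k%:R ^+ 2 / (2 * beta ^+ 2))) f x0| <= K * (Num.sqrt n%:R)^-1.
Proof.
have [K HK] := interp_step.
have C0 := C_ge0; have B' := ltW beta0.
have K0 : 0 <= K.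
  have := HK 1%N 0 0%N isT; rewrite muln1 => /(_ k0) /(le_trans (normr_ge0 _)).
  by rewrite sqrtr1 invr1 expr1n mulr1.
pose N1 := gE (fun y : R => 6 * envelope y).
have iN : gint (fun y : R => 6 * envelope y).
  apply: (@integrable_envelope _ _ 6); last first.
    by move=> y; rewrite ger0_norm// mulr_ge0// (le_trans ler01 (envelope_ge1 y)).
  apply: measurable_funM => //; apply: measurable_funD;
  by apply: measurableT_comp => //; exact: measurable_funM.
exists (k%:R * K + C * (Num.sqrt (k%:R / 2) / beta) * N1) => n x0 n0.
have np : (0 : R) < n%:R by rewrite ltr0n.
set q := (Num.sqrt n%:R)^-1.
have q0 : 0 < q by rewrite invr_gt0 sqrtr_gt0.
have Q' := ltW q0.
have qq : q ^+ 2 = n%:R^-1 by rewrite /q exprVn sqr_sqrtr.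
have step t : (t <= k * n)%N ->
   `|occE t (interp (n := n) x0 t) - interp (n := n) x0 0 (fun=> 0%N)| <= t%:R * (K * q ^+ 3).
  elim: t => [|t IH] tkn; first by rewrite /occE/= subrr normr0 mul0r.
  rewrite -natr1 mulrDl mul1r.
  have := HK n x0 t n0 tkn; have := IH (ltnW tkn).
  set A := occE t _; set B := occE t.+1 _; set I0 := interp _ _ _ => h1 h2.
  have -> : B - I0 = (A - I0) + (B - A) by ring.
  by rewrite (le_trans (ler_normD _ _))// lerD.
have i00 : interp (n := n) x0 0 (fun=> 0%N) =
    gauss_sm (Num.sqrt (k%:R ^+ 2 / (2 * beta ^+ 2))) f x0.
  rewrite /interp /remvar mul0r mul0r subr0 /centred /Wbin /Abin big1 // /abin bin0n.
  by rewrite !mul0r subrr oppr0 mul0r addr0.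
rewrite -i00.
set E := occE _ _.
(* At [t = k * n] a smoothing of deviation proportional to [q] remains; the Lipschitz bound on [f]
   removes it at cost [O(q)], with [N1] dominating the first absolute moment. *)
have hE : `|E - occE (k * n) (interp (n := n) x0 (k * n))| <=
    C * (Num.sqrt (k%:R / 2) / beta) * N1 * q.
  set s := Num.sqrt (remvar n (k * n)).
  have sE : s = Num.sqrt (k%:R / 2) / beta * q.
    have bz : beta != 0 by rewrite gt_eqF.
    rewrite /s (_ : remvar n (k * n) = (k%:R / 2) * (q / beta) ^+ 2).
      have qb : 0 <= q / beta by nneg.
      by rewrite sqrtrM ?divr_ge0// sqrtr_sqr (ger0_norm qb); ring.
    by rewrite /remvar expr_div_n qq natrM; field; rewrite bz gt_eqF.
  rewrite /E -occEB (le_trans (occE_norm _ _))// -[leRHS](@occE_cst R n (k * n))//.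
  apply: occE_le => d _; rewrite /interp -/s; set x := x0 + _.
  have [[cf _ _] b l _] := sm.
  have fC y : `|f y| <= C by case: (b y).
  have i y t := gint_affine y t cf fC.
  rewrite distrC -[f x]gE_cst -gEB//; last exact: gint_cst.
  rewrite (_ : C * _ * N1 * q = C * s * N1); last by rewrite sE; ring.
  have s0 : 0 <= s by rewrite sqrtr_ge0.
  rewrite -gEZ//; apply: gE_norm_le.
  - by apply: gintB => //; exact: gint_cst.
  - exact: gintZ.
  - move=> y; apply: (le_trans (l _ _)); rewrite normrM (ger0_norm s0) [leLHS]mulrA.
    apply: ler_wpM2l; first exact: mulr_ge0.
    by have := norm_envelope y (isT : (1 <= 3)%N); rewrite expr1.
have -> : E - interp (n := n) x0 0 (fun=> 0%N) =
   (occE (k * n) (interp (n := n) x0 (k * n)) - interp (n := n) x0 0 (fun=> 0%N))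
    + (E - occE (k * n) (interp (n := n) x0 (k * n))) by ring.
rewrite (le_trans (ler_normD _ _))// mulrDl lerD//.
apply: (le_trans (step _ (leqnn _))).
rewrite natrM (_ : k%:R * n%:R * (K * q ^+ 3) = k%:R * K * q * (n%:R * q ^+ 2)); last by ring.
by rewrite qq divff ?mulr1// gt_eqF.
Qed.

End Lindeberg.

(** * The truncated exponential [psi] and its smooth approximations *)

Section Psi.
Context {R : realType}.

Definition psi (x : R) : R := Num.min 1 (expR (- x)).

Lemma psi_gt0 x : 0 < psi x.
Proof. by rewrite lt_min ltr01 expR_gt0. Qed.

Lemma psi_le1 x : psi x <= 1.
Proof. by rewrite ge_min lexx. Qed.

(** For [x <= y], [psi] decreases, but by no more than the factor [expR (- (y - x)) >= 1 - (y - x)];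
    as [psi <= 1], the drop is at most [y - x]. *)
Lemma psi_lip x y : `|psi x - psi y| <= `|x - y|.
Proof.
wlog xy : x y / x <= y.
  by move=> H; case: (leP x y) => [/H//|/ltW/H]; rewrite distrC (distrC y).
have psile : psi y <= psi x.
  by rewrite /psi le_min !ge_min lexx/= ler_expR lerN2 xy orbT.
have low : psi x * expR (- (y - x)) <= psi y.
  rewrite /psi le_min; apply/andP; split.
    rewrite -[leRHS]mulr1 ler_pM ?expR_ge0 ?psi_le1 ?(ltW (psi_gt0 x))//.
    by rewrite -expR0 ler_expR oppr_le0 subr_ge0.
  apply: (@le_trans _ _ (expR (- x) * expR (- (y - x)))).
    by rewrite ler_wpM2r ?expR_ge0// ge_min lexx orbT.
  by rewrite -expRD -opprD addrC subrK.
have e1 := expR_ge1Dx (- (y - x)).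
rewrite ger0_norm ?subr_ge0// ler0_norm ?subr_le0// opprB.
have : psi x * (1 - (y - x)) <= psi x * expR (- (y - x)) by rewrite ler_wpM2l// ltW// psi_gt0.
have : psi x * (y - x) <= y - x by rewrite ler_piMl ?subr_ge0// psi_le1.
by rewrite mulrBr; lra.
Qed.

Lemma psi_ge0E x : 0 <= x -> psi x = expR (- x).
Proof. by move=> x0; rewrite /psi min_r// -expR0 ler_expR oppr_le0. Qed.

Lemma psi_le0E x : x <= 0 -> psi x = 1.
Proof. by move=> x0; rewrite /psi min_l// -expR0 ler_expR oppr_ge0. Qed.

Variable (p : R).
Hypothesis p1 : 1 <= p.
Let p0 : 0 < p. Proof. exact: lt_le_trans p1. Qed.
Let pz : p != 0. Proof. by rewrite gt_eqF. Qed.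

(* [softmin x = (1 + exp (p x)) ^ (- 1 / p)] is a smooth approximation of [psi] whose derivatives
   are polynomials in [softmin] and [wgt]. *)
Definition lse (x : R) : R := ln (1 + expR (p * x)) / p.
Definition softmin (x : R) : R := expR (- lse x).
Definition wgt (x : R) : R := 1 - (1 + expR (p * x))^-1.
Definition softmin1 x := - softmin x * wgt x.
Definition softmin2 x := softmin x * ((1 + p) * wgt x ^+ 2 - p * wgt x).
Definition softmin3 x := softmin1 x * ((1 + p) * wgt x ^+ 2 - p * wgt x)
  + softmin x * (((1 + p) * (2 * wgt x) - p) * (p * wgt x * (1 - wgt x))).

(** [softmin x] is [psi (lse x)], and [lse x] exceeds the positive part of [x] by
    [ln (1 + exp(- p |x|)) / p], at most [1 / p]. Since [psi] only sees the positive part and is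
    1-Lipschitz, the bound follows. *)
Lemma softmin_psi x : `|softmin x - psi x| <= p^-1.
Proof.
have E0 : 0 < expR (p * x) by exact: expR_gt0.
have lse0 : 0 <= lse x by rewrite divr_ge0 ?(ltW p0)// ln_ge0// lerDl ltW.
rewrite /softmin -(psi_ge0E lse0); have [x0|x0] := leP x 0.
  rewrite -(_ : psi 0 = psi x); last by rewrite !psi_le0E.
  rewrite (le_trans (psi_lip _ _))// subr0 ger0_norm// ler_piMl ?invr_ge0 ?(ltW p0)//.
  rewrite (le_trans (le_ln1Dx _))//; first by rewrite (lt_trans _ E0).
  by rewrite -expR0 ler_expR mulr_ge0_le0// ltW.
rewrite (le_trans (psi_lip _ _))//.
have -> : lse x - x = ln (1 + expR (- (p * x))) / p.
  rewrite /lse (_ : 1 + expR (p * x) = expR (p * x) * (1 + expR (- (p * x)))); last first.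
    by rewrite mulrDr mulr1 -expRD subrr expR0 addrC.
  by rewrite lnM ?posrE ?addr_gt0 ?expR_gt0// expRK; field.
have E0' : 0 < expR (- (p * x)) by exact: expR_gt0.
rewrite ger0_norm; last by rewrite divr_ge0 ?(ltW p0)// ln_ge0// lerDl ltW.
rewrite ler_piMl ?invr_ge0 ?(ltW p0)//.
rewrite (le_trans (le_ln1Dx _))//; first by rewrite (lt_trans _ E0').
by rewrite -[leRHS]expR0 ler_expR oppr_le0 mulr_ge0// ltW.
Qed.

Lemma wgt01 x : 0 <= wgt x <= 1.
Proof.
have E0 : 0 < expR (p * x) by exact: expR_gt0.
by rewrite /wgt subr_ge0 invf_le1 ?addr_gt0// lerDl (ltW E0)/= gerBl invr_ge0 addr_ge0// ltW.
Qed.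

Lemma softmin01 x : 0 <= softmin x <= 1.
Proof.
have E0 : 0 < expR (p * x) by exact: expR_gt0.
rewrite expR_ge0/= -expR0 ler_expR oppr_le0 divr_ge0 ?(ltW p0)// ln_ge0// lerDl ltW//.
Qed.

Let dexp (x : R) : is_derive x 1 (fun x => 1 + expR (p * x)) (p * expR (p * x)).
Proof.
have d1 : is_derive x 1 ( *%R p) p.
  by apply: is_derive_eq; rewrite /GRing.scale/= mulr1.
have d2 := @is_derive1_comp R (@expR R) ( *%R p) x (expR (p * x)) p (is_derive_expR _) d1.
have d3 : is_derive x 1 (cst 1 + (@expR R \o *%R p)) (0 + expR (p * x) * p) by exact: is_deriveD.
by rewrite add0r mulrC in d3.
Qed.

Let den (x : R) : 1 + expR (p * x) != 0.
Proof. by rewrite gt_eqF// addr_gt0// expR_gt0. Qed.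

Let dwgt (x : R) : is_derive x 1 wgt (p * wgt x * (1 - wgt x)).
Proof.
have d1 := dexp x; have dn := den x.
have d2 : is_derive x 1 (fun x => (1 + expR (p * x))^-1)
    (- (1 + expR (p * x)) ^- 2 *: (p * expR (p * x))).
  exact: is_deriveV.
have d3 : is_derive x 1 (cst 1 - (fun x => (1 + expR (p * x))^-1))
    (0 - (- (1 + expR (p * x)) ^- 2 *: (p * expR (p * x)))).
  exact: is_deriveB.
apply: (is_derive_eq d3); rewrite /wgt /GRing.scale/=; by field.
Qed.

Let dsoft (x : R) : is_derive x 1 softmin (softmin1 x).
Proof.
have d1 := dexp x; have dn := den x.
have d2 : is_derive (1 + expR (p * x)) 1 (@ln R) (1 + expR (p * x))^-1.
  by apply: is_derive1_ln; rewrite addr_gt0// expR_gt0.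
have d3 := @is_derive1_comp R (@ln R) (fun x => 1 + expR (p * x)) x _ _ d2 d1.
have d4 : is_derive x 1 (fun x => - p^-1 * ln (1 + expR (p * x)))
   (- p^-1 * ((1 + expR (p * x))^-1 * (p * expR (p * x)))).
  by apply: is_derive_eq; rewrite /GRing.scale/= ?mulr0 ?addr0 ?add0r.
have d5 := is_derive1_comp (is_derive_expR _) d4.
rewrite (_ : softmin = expR \o (fun x => - p^-1 * ln (1 + expR (p * x)))); last first.
  by apply/funext => y; rewrite /softmin /lse/= mulNr mulrC.
apply: (is_derive_eq d5); rewrite /softmin1 /softmin /lse /wgt.
rewrite (_ : - p^-1 * ln (1 + expR (p * x)) = - (ln (1 + expR (p * x)) / p)); last first.
  by rewrite mulNr mulrC.
by field; rewrite dn pz.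
Qed.

Let dsoft1 (x : R) : is_derive x 1 softmin1 (softmin2 x).
Proof.
have d1 := dsoft x; have d2 := dwgt x.
have d3 : is_derive x 1 (- softmin * wgt)
    (- softmin x *: (p * wgt x * (1 - wgt x)) + wgt x *: (- softmin1 x)).
  exact: is_deriveM.
by apply: (is_derive_eq d3); rewrite /softmin2 /softmin1 /GRing.scale/=; ring.
Qed.

Let dsoft2 (x : R) : is_derive x 1 softmin2 (softmin3 x).
Proof.
have d1 := dsoft x; have d2 := dwgt x.
have d3 : is_derive x 1 (fun x => (1 + p) * wgt x ^+ 2 - p * wgt x)
    (((1 + p) * (2 * wgt x) - p) * (p * wgt x * (1 - wgt x))).
  by apply: is_derive_eq; rewrite /GRing.scale/= ?mulr0 ?addr0 ?add0r ?expr1; ring.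
have d4 : is_derive x 1 (softmin * (fun x => (1 + p) * wgt x ^+ 2 - p * wgt x))
  (softmin x *: (((1 + p) * (2 * wgt x) - p) * (p * wgt x * (1 - wgt x)))
    + ((1 + p) * wgt x ^+ 2 - p * wgt x) *: softmin1 x).
  exact: is_deriveM.
by apply: (is_derive_eq d4); rewrite /softmin3 /GRing.scale/=; ring.
Qed.

Let derive_cont (g dg : R -> R) : (forall x : R, is_derive x 1 g (dg x)) -> continuous g.
Proof.
by move=> gdg x; apply: differentiable_continuous; apply/derivable1_diffP; case: (gdg x).
Qed.

Lemma softmin_smooth : smooth3 softmin softmin1 softmin2 (1 + 2 * p + (2 + 3 * p) * p).
Proof.
(* As [wgt] and [softmin] lie in [0, 1], the third derivative is bounded by [1 + 2 p] for its first
   summand and [(2 + 3 p) p] for its second; the lower derivatives are smaller. *)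
set C := _ + _ * _.
have pp : 0 <= p * p by rewrite mulr_ge0 ?(ltW p0).
have C1 : 1 <= C by rewrite /C; have := p1; nra.
have wq x : `|(1 + p) * wgt x ^+ 2 - p * wgt x| <= 1 + 2 * p.
  have /andP[w0 w1] := wgt01 x.
  have h1 : 0 <= (1 + p) * wgt x ^+ 2 <= 1 + p.
    have w2 : 0 <= wgt x ^+ 2 <= 1 by rewrite exprn_ge0//= exprn_ile1.
    by have pp0 := p0; case/andP: w2 => ? ?; apply/andP; split; nra.
  have h2 : 0 <= p * wgt x <= p by have pp0 := p0; apply/andP; split; nra.
  by have pp0 := p0; case/andP: h1 => ? ?; case/andP: h2 => ? ?; rewrite ler_norml; lra.
have b0 x : `|softmin x| <= 1 by have /andP[s0 s1] := softmin01 x; rewrite ger0_norm.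
have b1 x : `|softmin1 x| <= 1.
  have /andP[w0 w1] := wgt01 x.
  by rewrite /softmin1 normrM normrN -[leRHS]mulr1 ler_pM// ger0_norm.
have b2 x : `|softmin2 x| <= C.
  rewrite /softmin2 normrM (@le_trans _ _ (1 * (1 + 2 * p)))//; first exact: ler_pM.
  by rewrite /C mul1r lerDl mulr_ge0 ?addr_ge0 ?mulr_ge0 ?(ltW p0).
have b3 x : `|softmin3 x| <= C.
  have /andP[w0 w1] := wgt01 x.
  rewrite /softmin3 (le_trans (ler_normD _ _))// /C lerD//.
    by rewrite normrM -[leRHS]mul1r ler_pM.
  rewrite normrM -[leRHS]mul1r ler_pM// normrM ler_pM//.
    have h : 0 <= (1 + p) * (2 * wgt x) <= (1 + p) * 2.
      by have pp0 := p0; apply/andP; split; nra.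
    by have pp0 := p0; case/andP: h => ? ?; rewrite ler_norml; lra.
  have hw : 0 <= wgt x * (1 - wgt x) <= 1 by apply/andP; split; nra.
  case/andP: hw => hw0 hw1; rewrite -mulrA normrM (ger0_norm (ltW p0)) (ger0_norm hw0).
  by rewrite ler_piMr ?(ltW p0).
split.
- split; [exact: derive_cont dsoft|exact: derive_cont dsoft1|exact: derive_cont dsoft2].
- by move=> x; split => //; apply: le_trans C1.
- move=> x u.
  have d (c : R) : is_derive c 1 (fun c : R => softmin (x + c)) (softmin1 (x + c)).
    have dx : is_derive c 1 (cst x + id : R -> R) (0 + 1) by exact: is_deriveD.
    rewrite add0r in dx; have := is_derive1_comp (dsoft (x + c)) dx.
    by rewrite mulr1.
  rewrite -[X in _ - softmin X]addr0.
  apply: (@mvt_bound _ (fun c => softmin (x + c)) (fun c => softmin1 (x + c))) => // c _.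
  exact: le_trans C1.
- move=> x u; exact: (@taylor2_bound R softmin softmin1 softmin2 softmin3 _ x u
    dsoft dsoft1 dsoft2 (fun c _ => b3 (x + c))).
Qed.

End Psi.

(** * Central limit theorem for the test function [psi] *)

Lemma near_le_inv_sqrt {R : realType} (K e : R) : 0 < e ->
  \forall n \near \oo, (0 < n)%N /\ K * (Num.sqrt n%:R)^-1 <= e.
Proof.
move=> e0; near=> n.
have n0 : (0 < n)%N by near: n; exact: nbhs_infty_gt.
split => //; have np : (0 : R) < n%:R by rewrite ltr0n.
have s0 : 0 < Num.sqrt n%:R :> R by rewrite sqrtr_gt0.
rewrite ler_pdivrMr//.
have [K0|K0] := leP K 0; first by rewrite (le_trans K0)// mulr_ge0// ltW.
rewrite mulrC -ler_pdivrMr// -(@ler_pXn2r _ 2) ?nnegrE ?divr_ge0 ?(ltW K0) ?(ltW e0) ?(ltW s0)//.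
rewrite sqr_sqrtr//; near: n; exact: nbhs_infty_ger.
Unshelve. all: by end_near. Qed.

Section PsiCLT.
Context {R : realType} (k : nat) (beta : R).
Hypotheses (k0 : (0 < k)%N) (beta0 : 0 < beta).

Lemma continuous_psi : continuous (@psi R).
Proof.
apply: (@lip_continuous R _ 1) => x u.
by rewrite (le_trans (psi_lip _ _))// mul1r addrAC subrr add0r.
Qed.

Lemma psi_norm_le1 (x : R) : `|psi x| <= 1.
Proof. by rewrite ger0_norm ?psi_le1// ltW// psi_gt0. Qed.

Lemma psi_clt (x0 e : R) : 0 < e -> \forall n \near \oo, (0 < n)%N /\
  `|occE (k * n) (fun d : 'I_n -> nat => psi (x0 + centred beta (k * n) d))
    - gauss_sm (Num.sqrt (k%:R ^+ 2 / (2 * beta ^+ 2))) (@psi R) x0| <= e.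
Proof.
move=> e0; set s := Num.sqrt _.
(* [p] is fixed before [n], since the Lindeberg constant depends on it; it makes replacing [psi] by
   [softmin p] cost at most [e / 4] on each side. *)
pose p := Num.max 1 (4 / e).
have p1 : 1 <= p by rewrite le_max lexx.
have p0 : 0 < p by exact: lt_le_trans p1.
have pe : p^-1 <= e / 4.
  by rewrite -[leRHS]invrK lef_pV2 ?posrE ?invr_gt0 ?divr_gt0// invf_div le_max lexx orbT.
have sm := softmin_smooth p1.
have [K HK] := lindeberg k0 beta0 sm.
have e2 : 0 < e / 2 by rewrite divr_gt0.
near=> n.
have [n0 hn] : (0 < n)%N /\ K * (Num.sqrt n%:R)^-1 <= e / 2.
  by near: n; exact: near_le_inv_sqrt.
split => //.
have h1 := HK n x0 n0; rewrite -/s in h1.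
have h2 : `|occE (k * n) (fun d : 'I_n -> nat => psi (x0 + centred beta (k * n) d))
   - occE (k * n) (fun d : 'I_n -> nat => softmin p (x0 + centred beta (k * n) d))| <= e / 4.
  rewrite -occEB (le_trans (occE_norm _ _))// -[leRHS](@occE_cst R n (k * n))//.
  by apply: occE_le => d _; rewrite distrC (le_trans (softmin_psi p1 _)).
have h3 : `|gauss_sm s (softmin p) x0 - gauss_sm s (@psi R) x0| <= e / 4.
  have [cf _ _] := smooth3_cont sm.
  have fC y : `|softmin p y| <= 1 by have /andP[? ?] := softmin01 p1 y; rewrite ger0_norm.
  have i1 := gint_affine x0 s cf fC.
  have i2 := gint_affine x0 s continuous_psi psi_norm_le1.
  rewrite -gEB// -[leRHS]gE_cst; apply: gE_norm_le.
  - exact: gintB.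
  - exact: gint_cst.
  - by move=> y; rewrite (le_trans (softmin_psi p1 _)).
move: h1 h2 h3.
set a := occE _ (fun _ => psi _); set b := occE _ (fun _ => softmin _ _).
set c := gauss_sm _ (softmin p) _; set g := gauss_sm _ (@psi R) _ => h1 h2 h3.
rewrite (_ : a - g = (a - b) + (b - c) + (c - g)); last by ring.
have t1 := ler_normD (a - b + (b - c)) (c - g); have t2 := ler_normD (a - b) (b - c).
lra.
Unshelve. all: by end_near. Qed.

End PsiCLT.

(** * Expansion of the log-likelihood ratio *)

Section LogLik.
Context {R : realType}.

Lemma ln1D_bound (x : R) : 0 <= x -> `|ln (1 + x) - (x - x ^+ 2 / 2)| <= x ^+ 3.
Proof.
move=> x0; pose g (t : R) := ln (1 + t) - (t - t ^+ 2 / 2).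
(* The derivative of the remainder is exactly [t ^ 2 / (1 + t)], so one application of the mean
   value theorem suffices. *)
have dg (t : R) : 0 <= t -> is_derive t 1 g (t ^+ 2 / (1 + t)).
  move=> t0; have t1 : 0 < 1 + t by rewrite ltr_wpDr.
  have d0 : is_derive t 1 (cst 1 + id : R -> R) (0 + 1) by exact: is_deriveD.
  have d1 : is_derive (1 + t) 1 (@ln R) (1 + t)^-1 by exact: is_derive1_ln.
  have d2 := is_derive1_comp (d1 : is_derive ((cst 1 + id) t) 1 (@ln R) _) d0.
  have d3 : is_derive t 1 (fun t => t - t ^+ 2 / 2) (1 - t).
    by apply: is_derive_eq; rewrite /GRing.scale/= ?mulr0 ?addr0 ?add0r ?mulr1; field.
  have d4 : is_derive t 1 ((@ln R \o (cst 1 + id)) - (fun t => t - t ^+ 2 / 2)) ((1 + t)^-1 * (0 + 1) - (1 - t)).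
    exact: is_deriveB.
  by apply: (is_derive_eq d4); field; rewrite gt_eqF.
have cg : {within `[0, x], continuous g}.
  apply: derivable_within_continuous => t; rewrite in_itv/= => /andP[t0 _].
  by case: (dg t t0).
have dg' t : t \in `]0, x[%R -> is_derive t 1 g (t ^+ 2 / (1 + t)).
  by rewrite in_itv/= => /andP[/ltW t0 _]; exact: dg.
have [c c0x] := @MVT_segment R g (fun t => t ^+ 2 / (1 + t)) 0 x x0 dg' cg.
rewrite /g addr0 ln1 expr0n/= mul0r !subr0 => ->.
have [cc0 ccx] : 0 <= c /\ c <= x by move: c0x; rewrite in_itv/= => /andP[].
have c1 : 0 < 1 + c by rewrite ltr_wpDr.
rewrite ger0_norm ?mulr_ge0 ?invr_ge0 ?exprn_ge0 ?(ltW c1)//.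
rewrite [leRHS]exprSr ler_wpM2r// ler_pdivrMr// (@le_trans _ _ (x ^+ 2))//.
  by rewrite lerXn2r.
by rewrite ler_peMr ?exprn_ge0// lerDl.
Qed.

Definition sumlog (a : R) (m : nat) : R := \sum_(i < m) ln (1 + i%:R / a).

Lemma rising_sumlog (a : R) m : 0 < a -> rising a m = a ^+ m * expR (sumlog a m).
Proof.
move=> a0; rewrite /rising /sumlog expR_sum -[in a ^+ m](card_ord m) -prodr_const -big_split/=.
apply: eq_bigr => i _; rewrite lnK ?posrE; first by field; rewrite gt_eqF.
by rewrite ltr_wpDr// divr_ge0// ltW.
Qed.

(* second-order expansion of [sumlog a m], as [i ^ 2] sums to [2 'C(m, 3) + 'C(m, 2)] *)
Definition sumlog2 (a : R) (m : nat) : R :=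
  'C(m, 2)%:R / a - (2 * 'C(m, 3)%:R + 'C(m, 2)%:R) / (2 * a ^+ 2).

(** The errors [(i / a) ^ 3] of the expansion of [ln (1 + i / a)] add up over [i < m] to at most
    [m ^ 4 / a ^ 3]. *)
Lemma sumlog_bound (a : R) m : 0 < a ->
  `|sumlog a m - sumlog2 a m| <= m%:R ^+ 4 / a ^+ 3.
Proof.
move=> a0; elim: m => [|m IH].
  by rewrite /sumlog /sumlog2 big_ord0 !bin0n !mulr0 !addr0 !mul0r subr0 oppr0 addr0 normr0 expr0n mul0r.
rewrite /sumlog big_ord_recr/= -/(sumlog a m).
have m0 : 0 <= m%:R / a by rewrite divr_ge0// ltW.
have b2 : 'C(m.+1, 2)%:R = 'C(m, 2)%:R + m%:R :> R by rewrite binS bin1 natrD.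
have b3 : 'C(m.+1, 3)%:R = 'C(m, 3)%:R + 'C(m, 2)%:R :> R by rewrite binS natrD.
have bm := @bin2R R m.
have bm' : 'C(m, 2)%:R = (m%:R ^+ 2 - m%:R) / 2 :> R by rewrite -bm; field.
have h := ln1D_bound m0.
rewrite (_ : _ + _ - _ = (sumlog a m - sumlog2 a m)
  + (ln (1 + m%:R / a) - (m%:R / a - (m%:R / a) ^+ 2 / 2))); last first.
  by rewrite /sumlog2 b3 b2 bm'; field; rewrite gt_eqF.
rewrite (le_trans (ler_normD _ _))// (le_trans (lerD IH h))//.
rewrite expr_div_n -mulrDl ler_wpM2r ?invr_ge0 ?exprn_ge0 ?(ltW a0)//.
rewrite -natr1; have : 0 <= (m%:R : R) by [].
set y := m%:R; move=> y0; have := mulr_ge0 y0 y0; have y3 : 0 <= y ^+ 3 by rewrite exprn_ge0.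
have y2 : 0 <= y ^+ 2 by rewrite exprn_ge0.
rewrite (_ : (y + 1) ^+ 4 = y ^+ 4 + y ^+ 3 + (3 * y ^+ 3 + 6 * y ^+ 2 + 4 * y + 1)); last by ring.
by rewrite lerDl !addr_ge0// mulr_ge0.
Qed.

Variables (k : nat) (beta : R).
Hypotheses (k0 : (0 < k)%N) (beta0 : 0 < beta).

(** Density of the preferential law with respect to the uniform one, as a function of the
    in-degrees. *)
Definition lik n (d : 'I_n -> nat) : R :=
  (\prod_j rising (beta * Num.sqrt n%:R) (d j)) / rising (beta * Num.sqrt n%:R * n%:R) (k * n) * n%:R ^+ (k * n).

Definition loglik n (d : 'I_n -> nat) : R :=
  \sum_j sumlog (beta * Num.sqrt n%:R) (d j) - sumlog (beta * Num.sqrt n%:R * n%:R) (k * n).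

(** The powers of [alpha] cancel because the in-degrees sum to [k * n], and [n ^ (k * n)] cancels
    against the normalising product. *)
Lemma lik_exp n (d : 'I_n -> nat) : (0 < n)%N -> balls d = (k * n)%N ->
  lik d = expR (loglik d).
Proof.
move=> n0 bd; have np : (0 : R) < n%:R by rewrite ltr0n.
rewrite /lik /loglik; set a := beta * _; have a0 : 0 < a by rewrite mulr_gt0// sqrtr_gt0.
have an0 : 0 < a * n%:R by rewrite mulr_gt0.
under eq_bigr do rewrite rising_sumlog//.
rewrite big_split/= prodrXr -/(balls d) bd -expR_sum rising_sumlog// expRB (exprMn _ a).
by field; rewrite expR_eq0 !expf_neq0 ?gt_eqF.
Qed.

Lemma loglik_approx : exists K : R, forall n, (0 < n)%N ->
  occE (k * n) (fun d : 'I_n -> nat =>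
    `|loglik d + k%:R ^+ 2 / (4 * beta ^+ 2) + centred beta (k * n) d|)
  <= K * (Num.sqrt n%:R)^-1.
Proof.
have [c2 c20 H2] := @Wbin_moment1 R k 2; have [c3 c30 H3] := @Wbin_moment1 R k 3.
have B' := ltW beta0.
(* In order: fluctuation of [A_3], second-order fluctuation of [A_2], deterministic remainder,
   expansion errors of the bins, expansion error of the normalising constant. *)
pose A1 : R := c3 / beta ^+ 2; pose A2 : R := c2 / (2 * beta ^+ 2).
pose A3 : R := (k%:R ^+ 2 + k%:R) / (4 * beta ^+ 2).
pose A4 : R := expR (15 * k%:R) / beta ^+ 3; pose A5 : R := k%:R ^+ 4 / beta ^+ 3.
exists (A1 + (A2 + (A3 + (A4 + A5)))) => n n0.
have np : (0 : R) < n%:R by rewrite ltr0n.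
have nz : (n%:R : R) != 0 by rewrite gt_eqF.
have bz : beta != 0 by rewrite gt_eqF.
set q := (Num.sqrt n%:R)^-1.
have q0 : 0 < q by rewrite invr_gt0 sqrtr_gt0.
have qz : q != 0 by rewrite gt_eqF.
have Q' := ltW q0.
have qq : q ^+ 2 = n%:R^-1 by rewrite /q exprVn sqr_sqrtr.
have q1 : q <= 1 by rewrite -(@expr_le1 _ 2)// qq invf_le1// ler1n.
have sq : Num.sqrt n%:R = q^-1 :> R by rewrite /q invrK.
have nq : n%:R = q ^- 2 :> R by rewrite qq invrK.
set m := (k * n)%N.
have a0 : 0 < beta * Num.sqrt n%:R by rewrite mulr_gt0// sqrtr_gt0.
have an0 : 0 < beta * Num.sqrt n%:R * n%:R by rewrite mulr_gt0.
apply: (@le_trans _ _ (occE m (fun d : 'I_n -> nat =>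
   (q ^+ 2 / beta ^+ 2) * `|Wbin 3 m d| + ((q ^+ 2 / (2 * beta ^+ 2)) * `|Wbin 2 m d|
   + ((k%:R ^+ 2 + k%:R) / (4 * beta ^+ 2) * q + (q ^+ 3 / beta ^+ 3 * (\sum_j 16 ^+ d j)
   + k%:R ^+ 4 / beta ^+ 3 * q)))))); last first.
  rewrite !occED !occE_cst// !occEZ.
  have h16 := @occE_sum_exp_le R n m k 16 n0 _ (leqnn _).
  have h2 := H2 n m n0 (leqnn _); have h3 := H3 n m n0 (leqnn _).
  rewrite sq in h2 h3.
  rewrite (mulrDl A1) (mulrDl A2) (mulrDl A3) (mulrDl A4); apply: lerD.
    rewrite (_ : A1 * q = q ^+ 2 / beta ^+ 2 * (c3 * q^-1)); last by rewrite /A1 /A2; field; rewrite bz qz.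
    by apply: ler_wpM2l => //; nneg.
  apply: lerD.
    rewrite (_ : A2 * q = q ^+ 2 / (2 * beta ^+ 2) * (c2 * q^-1)); last by rewrite /A1 /A2; field; rewrite bz qz.
    by apply: ler_wpM2l => //; nneg.
  rewrite lerD2l lerD2r.
  rewrite (_ : A4 * q = q ^+ 3 / beta ^+ 3 * (n%:R * expR ((16 - 1) * k%:R))).
    by apply: ler_wpM2l; [nneg|apply: h16; lra].
  have -> : 16 - 1 = 15 :> R by ring.
  rewrite nq /A4; field. by rewrite bz qz.
apply: occE_le => d bd.
have hm : `|sumlog (beta * Num.sqrt n%:R * n%:R) m
    - sumlog2 (beta * Num.sqrt n%:R * n%:R) m| <= k%:R ^+ 4 / beta ^+ 3 * q.
  apply: (le_trans (sumlog_bound m an0)).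
  rewrite /m natrM sq nq le_eqVlt; apply/orP; left; apply/eqP; field.
  by rewrite bz qz.
have hs : `|\sum_j (sumlog (beta * Num.sqrt n%:R) (d j)
    - sumlog2 (beta * Num.sqrt n%:R) (d j))| <= q ^+ 3 / beta ^+ 3 * (\sum_j 16 ^+ d j).
  rewrite (le_trans (ler_norm_sum _ _ _))// big_distrr/= ler_sum// => j _.
  apply: (le_trans (sumlog_bound (d j) a0)).
  rewrite (_ : _ / _ = q ^+ 3 / beta ^+ 3 * (d j)%:R ^+ 4); last by rewrite sq; field; rewrite bz qz.
  apply: ler_wpM2l; first nneg.
  rewrite -[16]/(16%:R) -!natrX ler_nat (_ : 16 = 2 ^ 4)%N// -expnM mulnC expnM leq_exp2r//.
  by rewrite ltnW// ltn_expl.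
(* Each [A_r] is written as its mean plus [Wbin r]. The linear term in [Wbin 2] cancels [centred],
   the means of [A_3] cancel, and the other constants cancel [k^2 / (4 beta^2)] up to [O(1 / n)]. *)
have E : loglik d + k%:R ^+ 2 / (4 * beta ^+ 2) + centred beta m d =
  (\sum_j (sumlog (beta * Num.sqrt n%:R) (d j) - sumlog2 (beta * Num.sqrt n%:R) (d j)))
  - (sumlog (beta * Num.sqrt n%:R * n%:R) m - sumlog2 (beta * Num.sqrt n%:R * n%:R) m)
  - q ^+ 2 / beta ^+ 2 * Wbin 3 m d - q ^+ 2 / (2 * beta ^+ 2) * Wbin 2 m d
  + (k%:R ^+ 2 * n%:R + k%:R * n%:R - k%:R) / (4 * beta ^+ 2 * n%:R ^+ 2).
  pose C2 : R := 'C(m, 2)%:R; pose C3 : R := 'C(m, 3)%:R.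
  have C2E : C2 = ((k%:R * n%:R) ^+ 2 - k%:R * n%:R) / 2 by rewrite -natrM -/m -bin2R; field.
  have -> : \sum_j (sumlog (beta * Num.sqrt n%:R) (d j) - sumlog2 (beta * Num.sqrt n%:R) (d j))
    = \sum_j sumlog (beta * Num.sqrt n%:R) (d j) - (Abin 2 d / (beta * Num.sqrt n%:R) - (2 * Abin 3 d + Abin 2 d) / (2 * (beta * Num.sqrt n%:R) ^+ 2)).
    rewrite /Abin /sumlog2 sumrB sumrB -!big_distrl/= big_split/= -big_distrr/=; by [].
  have -> : Abin 2 d = Wbin 2 m d + C2 / n%:R.
    by rewrite /Wbin /abin -/C2; field.
  have -> : Abin 3 d = Wbin 3 m d + C3 / n%:R ^+ 2.
    by rewrite /Wbin /abin -/C3; field.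
  rewrite /loglik /sumlog2 -/m -/C2 -/C3 /centred C2E sq nq; field.
  by rewrite bz qz.
have hc : `|(k%:R ^+ 2 * n%:R + k%:R * n%:R - k%:R) / (4 * beta ^+ 2 * n%:R ^+ 2)|
    <= (k%:R ^+ 2 + k%:R) / (4 * beta ^+ 2) * q.
  have kn : k%:R <= k%:R * n%:R :> R by rewrite ler_peMr// ler1n.
  have k2 : 0 <= k%:R ^+ 2 * n%:R :> R by nneg.
  have D0 : 0 <= (4 * beta ^+ 2)^-1 by nneg.
  have D1 : 0 <= (4 * beta ^+ 2 * n%:R ^+ 2)^-1 by nneg.
  rewrite ger0_norm; last by apply: mulr_ge0 => //; lra.
  apply: (@le_trans _ _ ((k%:R ^+ 2 * n%:R + k%:R * n%:R) / (4 * beta ^+ 2 * n%:R ^+ 2))).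
    by apply: ler_wpM2r => //; rewrite gerBl.
  rewrite (_ : _ / _ = (k%:R ^+ 2 + k%:R) / (4 * beta ^+ 2) * (q * q)); last first.
    by rewrite nq; field; rewrite bz qz.
  by apply: ler_wpM2l; [nneg|rewrite ler_piMr].
rewrite E.
have norm5 (x y z w v : R) : `|x - y - z - w + v| <= `|z| + (`|w| + (`|v| + (`|x| + `|y|))).
  have := ler_normD (x - y - z - w) v; have := ler_normB (x - y - z) w.
  by have := ler_normB (x - y) z; have := ler_normB x y; lra.
apply: (le_trans (norm5 _ _ _ _ _)).
have Z3 : 0 <= q ^+ 2 / beta ^+ 2 by nneg.
have Z2 : 0 <= q ^+ 2 / (2 * beta ^+ 2) by nneg.
rewrite normrM (ger0_norm Z3) lerD2l normrM (ger0_norm Z2) lerD2l.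
by rewrite lerD// lerD.
Qed.

End LogLik.

(** * Total variation distance of the image laws under a statistic *)

Section TotalVariation.
Context {R : realType} {T : finType} (X : T -> nat).

Lemma sum_fibers (H : T -> R) :
  \sum_(x <- undup [seq X M | M <- enum T]) \sum_(M | X M == x) H M = \sum_M H M.
Proof.
rewrite (exchange_big_dep xpredT)//=; apply: eq_bigr => M _.
have XM : X M \in undup [seq X M | M <- enum T].
  by rewrite mem_undup; apply/mapP; exists M; rewrite ?mem_enum.
rewrite big_mkcond (bigD1_seq (X M))//= ?undup_uniq// eqxx big1 ?addr0// => x.
by rewrite eq_sym => /negbTE ->.
Qed.

Lemma half_dist_min (p q : R) : 2^-1 * `|p - q| = (p + q) / 2 - Num.min p q.
Proof.
case: (leP p q) => pq; first by rewrite ler0_norm ?subr_le0//; field.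
by rewrite gtr0_norm ?subr_gt0//; field.
Qed.

Variables (P Q : T -> R).
Hypotheses (P1 : \sum_M P M = 1) (Q1 : \sum_M Q M = 1).

(** Unfolds to [dTV_X] when [X] is [Xsq]. *)
Definition tv : R := 2^-1 * \sum_(x <- undup [seq X M | M <- enum T])
  `|\sum_(M | X M == x) P M - \sum_(M | X M == x) Q M|.

Lemma tvE : 1 - tv = \sum_(x <- undup [seq X M | M <- enum T])
  Num.min (\sum_(M | X M == x) P M) (\sum_(M | X M == x) Q M).
Proof.
rewrite /tv big_distrr/=; under eq_bigr do rewrite half_dist_min.
rewrite sumrB -big_distrl/= big_split/= !sum_fibers P1 Q1.
rewrite (_ : (1 + 1) / 2 = 1); last by field.
by rewrite opprB addrC subrK.
Qed.

(** Merging the points of a fibre can only increase the overlap: a sum of minima is below the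
    minimum of the sums. *)
Lemma tv_ge : \sum_M Num.min (P M) (Q M) <= 1 - tv.
Proof.
rewrite tvE -[leLHS]sum_fibers ler_sum// => x _.
by rewrite le_min !ler_sum// => M _; rewrite ge_min lexx ?orbT.
Qed.

(** Since [rho] is constant on each fibre of [X], there the overlap is at most [Num.min rho 1] times
    the mass of [Q], up to [e]. This reverses [tv_ge] for a density that is nearly a function of
    [X]. *)
Lemma tv_le (rho : nat -> R) (e : T -> R) : (forall M, 0 <= e M) ->
  (forall M, P M <= rho (X M) * Q M + e M) ->
  1 - tv <= \sum_M Q M * Num.min (rho (X M)) 1 + \sum_M e M.
Proof.
move=> e0 Pe; rewrite tvE -big_split/= -[leRHS]sum_fibers ler_sum// => x _.
case: (leP (rho x) 1) => rx.
  apply: (@le_trans _ _ (\sum_(M | X M == x) P M)); first by rewrite ge_min lexx.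
  by apply: ler_sum => M /eqP Mx; rewrite Mx (min_l rx) mulrC -{1}Mx Pe.
apply: (@le_trans _ _ (\sum_(M | X M == x) Q M)); first by rewrite ge_min lexx orbT.
by apply: ler_sum => M /eqP Mx; rewrite Mx (min_r (ltW rx)) mulr1 lerDl.
Qed.

End TotalVariation.

(** * Uniform maps as independent balls *)

Section MapSums.
Context {R : realType}.

Lemma big_tupleS (T : finType) p (G : p.+1.-tuple T -> R) :
  \sum_w G w = \sum_x \sum_(w : p.-tuple T) G [tuple of x :: w].
Proof.
rewrite pair_big/= (reindex (fun xw : T * p.-tuple T => [tuple of xw.1 :: xw.2]))//=.
exists (fun w => (thead w, [tuple of behead w])) => [[x w] _|w _] /=.
  by congr (_, _); apply: val_inj.
by rewrite -tuple_eta.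
Qed.

(** The arbitrary starting occupancy [d] lets the induction continue from the balls already
    placed. *)
Lemma sum_tuple_throw n p F (d : 'I_n -> nat) : (0 < n)%N ->
  \sum_(w : p.-tuple 'I_n) F (fun j => d j + count_mem j w)%N =
  n%:R ^+ p * iter p throw F d :> R.
Proof.
move=> n0; have nz : (n%:R : R) != 0 by rewrite pnatr_eq0 -lt0n.
elim: p d => [|p IH] d.
  rewrite (big_pred1 [tuple]) => [|w]; last by apply/esym/eqP; exact: tuple0.
  by rewrite expr0 mul1r /=; congr F; apply/funext => j; rewrite addn0.
rewrite big_tupleS iterS -[throw _ d]/(n%:R^-1 * \sum_x iter p throw F (addball d x)) exprS.
rewrite mulrACA divff// mul1r big_distrr/=; apply: eq_bigr => x _.
rewrite -IH; apply: eq_bigr => w _; congr F; apply/funext => j /=.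
by rewrite /addball addnA eq_sym.
Qed.

Lemma sum_tuples_throw n k p F (d : 'I_n -> nat) : (0 < n)%N ->
  \sum_(M : p.-tuple (k.-tuple 'I_n))
     F (fun j => d j + \sum_(i < p) count_mem j (tnth M i))%N =
  n%:R ^+ (k * p) * iter (k * p) throw F d :> R.
Proof.
move=> n0; elim: p d => [|p IH] d.
  rewrite (big_pred1 [tuple]) => [|w]; last by apply/esym/eqP; exact: tuple0.
  by rewrite muln0 expr0 mul1r /=; congr F; apply/funext => j; rewrite big_ord0 addn0.
rewrite big_tupleS mulnS iterD exprD mulrAC -sum_tuple_throw// big_distrl/=.
apply: eq_bigr => x _; rewrite mulrC -IH; apply: eq_bigr => M _.
congr F; apply/funext => j; rewrite big_ord_recl tnth0 addnA; congr (_ + _)%N.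
by apply: eq_bigr => i _; rewrite tnthS.
Qed.

(** Read vertex by vertex, the arcs of a uniform map are [k * n] independent uniform balls whose
    occupancy numbers are the in-degrees. *)
Lemma sum_kmap n k (F : ('I_n -> nat) -> R) : (0 < n)%N ->
  \sum_(M : kmap n k) law_unif M * F (indeg M) = occE (k * n) F.
Proof.
move=> n0; have nz : (n%:R : R) != 0 by rewrite pnatr_eq0 -lt0n.
rewrite /law_unif -big_distrr/=.
rewrite (reindex (fun w : n.-tuple (k.-tuple 'I_n) => [ffun i => tnth w i])); last first.
  exists (fun M : kmap n k => [tuple M i | i < n]) => [w _|M _].
    by apply: eq_from_tnth => i; rewrite tnth_mktuple ffunE.
  by apply/ffunP => i; rewrite ffunE tnth_mktuple.
rewrite /occE; apply: (canLR (mulKf _)); first by rewrite expf_neq0.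
rewrite -sum_tuples_throw//; apply: eq_bigr => w _; congr F; apply/funext => j.
by rewrite /indeg add0n; apply: eq_bigr => i _; rewrite ffunE.
Qed.

Lemma balls_indeg n k (M : kmap n k) : balls (indeg M) = (k * n)%N.
Proof.
rewrite /balls /indeg exchange_big/=.
under eq_bigr => i _.
  rewrite (_ : (\sum_j count_mem j (M i))%N = k); first over.
  rewrite -[RHS](size_tuple (M i)); elim: (val (M i)) => [|x s IH]; first by rewrite big1.
  rewrite /= big_split/= IH (bigD1 x)//= eqxx big1 ?addn0//.
  by move=> j /negbTE; rewrite eq_sym => ->.
by rewrite sum_nat_const card_ord mulnC.
Qed.

End MapSums.

(** * Two-sided bounds on the distance and passage to the limit *)

Section Comparison.
Context {R : realType}.

Lemma risingS (x : R) m : rising x m.+1 = rising x m * (x + m%:R).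
Proof. by rewrite /rising big_ord_recr. Qed.

Lemma rising_gt0 (x : R) m : 0 < x -> 0 < rising x m.
Proof. by move=> x0; apply: prodr_gt0 => i _; rewrite ltr_wpDr. Qed.

(* The likelihood ratio of the preferential to the uniform allocation is a martingale. *)
Lemma occE_urn n t (a : R) : (0 < n)%N -> 0 < a ->
  occE t (fun d : 'I_n -> nat =>
    (\prod_j rising a (d j)) / rising (a * n%:R) t * n%:R ^+ t) = 1.
Proof.
move=> n0 a0; have nz : (n%:R : R) != 0 by rewrite pnatr_eq0 -lt0n.
have np : (0 : R) < n%:R by rewrite ltr0n.
elim: t => [|t IH].
  rewrite /occE /= big1 => [|j _]; last by rewrite /rising big_ord0.
  by rewrite /rising big_ord0 expr0 divr1 mulr1.
rewrite occES -[RHS]IH; apply: eq_occE => d bd; rewrite /throw /=.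
have E j : (\prod_i rising a (addball d j i)) = (\prod_i rising a (d i)) * (a + (d j)%:R).
  rewrite (bigD1 j)//= [in RHS](bigD1 j)//= /addball eqxx addn1 risingS.
  rewrite (eq_bigr (fun i => rising a (d i))); first by ring.
  by move=> i /negbTE ->; rewrite addn0.
under eq_bigr do rewrite E.
rewrite -!big_distrl/= -big_distrr/= big_split/= sumr_const card_ord -[_ *+ n]mulr_natr.
rewrite -natr_sum -/(balls d) bd risingS exprS; field.
by rewrite nz gt_eqF ?rising_gt0 ?mulr_gt0//= gt_eqF// ltr_wpDr// mulr_gt0.
Qed.

Variables (k : nat) (beta : R).
Hypotheses (k0 : (0 < k)%N) (beta0 : 0 < beta).
Let mu : R := k%:R ^+ 2 / (4 * beta ^+ 2).
Let s : R := Num.sqrt (k%:R ^+ 2 / (2 * beta ^+ 2)).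
Local Notation dist n := (dTV_X (@law_alpha R n k (beta * Num.sqrt n%:R)) (@law_unif R n k)).

Definition psiE n (x : R) : R :=
  occE (k * n) (fun d : 'I_n -> nat => psi (x + centred beta (k * n) d)).
Definition logerr n : R :=
  occE (k * n) (fun d : 'I_n -> nat => `|loglik k beta d + mu + centred beta (k * n) d|).

Lemma law_alphaE n (M : kmap n k) : (0 < n)%N ->
  law_alpha (beta * Num.sqrt n%:R) M = law_unif M * lik k beta (indeg M).
Proof.
move=> n0; rewrite /law_alpha /law_unif /lik mulrCA mulVf ?mulr1//.
by rewrite expf_neq0// pnatr_eq0 -lt0n.
Qed.

Lemma sum_law_alpha n : (0 < n)%N ->
  \sum_(M : kmap n k) law_alpha (beta * Num.sqrt n%:R) M = 1.
Proof.
move=> n0; under eq_bigr do rewrite law_alphaE//.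
by rewrite sum_kmap// occE_urn// mulr_gt0// sqrtr_gt0 ltr0n.
Qed.

Lemma sum_law_unif n : (0 < n)%N -> \sum_(M : kmap n k) law_unif M = 1 :> R.
Proof.
move=> n0; under eq_bigr do rewrite -[law_unif _]mulr1.
by rewrite (@sum_kmap R n k (fun=> 1))// occE_cst.
Qed.

Lemma law_unif_ge0 n (M : kmap n k) : 0 <= law_unif M :> R.
Proof. by rewrite /law_unif invr_ge0 exprn_ge0. Qed.

(** [centred] expressed through [X], by [A_2 = (X - k n) / 2]. *)
Definition centredX n (x : nat) : R :=
  - ((x%:R - (k * n)%:R) / 2 - @abin R n 2 (k * n)) / (beta * Num.sqrt n%:R).

Lemma centred_indeg n (M : kmap n k) : centred beta (k * n) (indeg M) = centredX n (Xsq M).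
Proof.
rewrite /centred /centredX /Wbin; congr (- (_ - _) / _).
rewrite /Abin /Xsq -(balls_indeg M) /balls !natr_sum -sumrB big_distrl/=.
by apply: eq_bigr => j _; rewrite natrX -bin2R; field.
Qed.

(** Truncating the density at any level [K] is a shift of [psi] by [ln K], so the limit theorem for
    [psi] serves every truncation level, including [K = 1]. *)
Lemma psi_lik n (d : 'I_n -> nat) (K : R) : (0 < n)%N -> 0 < K -> balls d = (k * n)%N ->
  K * psi (ln K - loglik k beta d) = Num.min K (lik k beta d).
Proof.
move=> n0 K0 bd; rewrite (lik_exp beta0 n0 bd) /psi minr_pMr ?(ltW K0)// mulr1.
by rewrite opprB expRD (expRN (ln K)) lnK ?posrE// mulrCA divff ?mulr1// gt_eqF.
Qed.

Lemma dist_le n : (0 < n)%N -> psiE n mu - logerr n <= 1 - dist n.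
Proof.
move=> n0; have h := tv_ge (@Xsq n k) (sum_law_alpha n0) (sum_law_unif n0).
apply: le_trans h; rewrite -occEB.
rewrite [leRHS](_ : _ = occE (k * n) (fun d : 'I_n -> nat => Num.min 1 (lik k beta d))).
  apply: occE_le => d bd; rewrite -psi_lik// ln1 sub0r mul1r lerBlDr.
  rewrite -lerBlDl (le_trans (ler_norm _))// (le_trans (psi_lip _ _))//.
  by rewrite opprK addrC addrA.
rewrite -sum_kmap//; apply: eq_bigr => M _.
by rewrite law_alphaE// minC minr_pMr ?law_unif_ge0// mulr1.
Qed.

Lemma dist_ge n (K : R) : (0 < n)%N -> 0 < K ->
  1 - dist n <= psiE n mu + (1 - K * psiE n (mu + ln K) + 2 * K * logerr n).
Proof.
move=> n0 K0.
(* With [g] the approximate density, [rho] is [min(K, g)], a function of [X] alone. The error [err]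
   is the tail [L - min(K, L)] plus the cost of replacing [L] by [g] inside the truncation. *)
pose rho x : R := K * psi (mu + ln K + centredX n x).
pose err (d : 'I_n -> nat) : R := lik k beta d - K * psi (ln K - loglik k beta d)
  + K * `|loglik k beta d + mu + centred beta (k * n) d|.
have shift (d : 'I_n -> nat) : K * psi (mu + ln K + centred beta (k * n) d) <=
     K * psi (ln K - loglik k beta d) + K * `|loglik k beta d + mu + centred beta (k * n) d| /\
   K * psi (ln K - loglik k beta d) <=
     K * psi (mu + ln K + centred beta (k * n) d) + K * `|loglik k beta d + mu + centred beta (k * n) d|.
  have := psi_lip (mu + ln K + centred beta (k * n) d) (ln K - loglik k beta d).
  rewrite (_ : _ - (ln K - _) = loglik k beta d + mu + centred beta (k * n) d); last by ring.
  rewrite ler_norml => /andP[h1 h2].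
  by split; rewrite -mulrDr ler_wpM2l ?(ltW K0)//; lra.
have err0 (M : kmap n k) : 0 <= law_unif M * err (indeg M).
  apply: mulr_ge0; first exact: law_unif_ge0.
  rewrite /err psi_lik ?balls_indeg//.
  by rewrite addr_ge0 ?subr_ge0 ?mulr_ge0 ?(ltW K0)// ge_min lexx orbT.
have dom (M : kmap n k) : law_alpha (beta * Num.sqrt n%:R) M <= rho (Xsq M) * law_unif M + law_unif M * err (indeg M).
  rewrite law_alphaE// mulrC [rho _ * _]mulrC -mulrDr mulrC ler_wpM2l ?law_unif_ge0//.
  by rewrite /rho -centred_indeg /err; have [_] := shift (indeg M); lra.
have h := tv_le (X := @Xsq n k) (sum_law_alpha n0) (sum_law_unif n0) err0 dom.
apply: (le_trans h); apply: lerD.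
  rewrite /psiE -sum_kmap//; apply: ler_sum => M _; rewrite ler_wpM2l ?law_unif_ge0//.
  rewrite centred_indeg /rho; set c := centredX _ _.
  rewrite /psi minr_pMr ?(ltW K0)// mulr1 le_min !ge_min lexx orbT/=.
  rewrite (_ : - (mu + ln K + c) = - ln K + - (mu + c)); last by ring.
  by rewrite expRD (expRN (ln K)) lnK ?posrE// mulrA divff ?mul1r ?lexx ?orbT// gt_eqF.
rewrite sum_kmap//.
(* A second use of [shift] moves the tail from [L] to [g], hence the factor [2 * K]; [occE_urn]
   gives [L] mean 1. *)
apply: (@le_trans _ _ (occE (k * n) (fun d : 'I_n -> nat => (lik k beta d
   - K * psi (mu + ln K + centred beta (k * n) d)) + 2 * K * `|loglik k beta d + mu + centred beta (k * n) d|))).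
  by apply: occE_le => d bd; rewrite /err; have [h1 _] := shift d; lra.
rewrite occED occEB !occEZ /logerr lerD2r /psiE lerD2r.
by rewrite occE_urn// mulr_gt0// sqrtr_gt0 ltr0n.
Qed.

Lemma gint_psi (x : R) : gint (fun y => psi (x + s * y)).
Proof. exact: gint_affine x s continuous_psi psi_norm_le1. Qed.

Let s2 : s ^+ 2 = 2 * mu.
Proof.
rewrite /s sqr_sqrtr; last by rewrite divr_ge0 ?mulr_ge0 ?exprn_ge0 ?(ltW beta0).
by rewrite /mu; field; rewrite gt_eqF.
Qed.

Let Y (y : R) : R := expR (- (mu + s * y)).

Let YE (y : R) : Y y = expR (- mu) * expR (- s * y).
Proof. by rewrite /Y -expRD; congr expR; ring. Qed.

Let iY : gint Y.
Proof.
rewrite (_ : Y = fun y => expR (- mu) * expR (- s * y)); last exact/funext/YE.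
by apply: gintZ; exact: gint_exp.
Qed.

(** The variance of the limit is twice its mean, so [E exp(- N) = exp(- mu + s^2 / 2) = 1]: the
    limiting density keeps full mass. *)
Let EY : gE Y = 1.
Proof.
rewrite (_ : Y = fun y => expR (- mu) * expR (- s * y)); last exact/funext/YE.
rewrite gEZ; last exact: gint_exp.
rewrite gE_exp -expRD sqrrN s2 (_ : - mu + _ = 0) ?expR0//; by field.
Qed.

Lemma truncated_mass (e : R) : 0 < e -> exists2 K : R, 0 < K &
  1 - K * gauss_sm s (@psi R) (mu + ln K) <= e.
Proof.
move=> e0.
pose Y2 (y : R) : R := expR (- 2 * mu) * expR (- 2 * s * y).
have Y2E y : Y2 y = Y y ^+ 2 by rewrite /Y2 /Y expr2 -!expRD; congr expR; ring.
have iY2 : gint Y2 by apply: gintZ; exact: gint_exp.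
pose B := gE Y2.
have B0 : 0 <= B.
  rewrite -(gE_cst 0); apply: le_gE => //; first exact: gint_cst.
  by move=> y; rewrite Y2E sqr_ge0.
(* The loss is at most [B / (4 K)]; this [K] makes it below [e], and the [+ 1] keeps [K]
   positive. *)
have [K K0 KE] : exists2 K, 0 < K & K * e = B + 1.
  by exists ((B + 1) / e); [rewrite divr_gt0// ltr_wpDl|rewrite divfK ?gt_eqF].
exists K => //.
have ipsi := gint_psi (mu + ln K).
have main : gE (fun y => Y y - (4 * K)^-1 * Y2 y) <= gE (fun y => K * psi (mu + ln K + s * y)).
  apply: le_gE; first by apply: gintB => //; exact: gintZ.
    exact: gintZ.
  move=> y; rewrite Y2E.
  have -> : K * psi (mu + ln K + s * y) = Num.min K (Y y).
    rewrite /psi minr_pMr ?(ltW K0)// mulr1.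
    rewrite (_ : - (mu + ln K + s * y) = - ln K + - (mu + s * y)); last by ring.
    by rewrite expRD (expRN (ln K)) lnK ?posrE// mulrA divff ?mul1r// gt_eqF.
  have K4 : 0 < 4 * K by rewrite mulr_gt0.
  rewrite le_min gerBl mulr_ge0 ?sqr_ge0 ?invr_ge0 ?(ltW K4)// andbT.
  (* [Y - Y ^ 2 / (4 K) <= K] is a perfect square being nonnegative. *)
  rewrite -subr_ge0 (_ : _ - _ = (4 * K)^-1 * (2 * K - Y y) ^+ 2); last by field; rewrite gt_eqF.
  by rewrite mulr_ge0 ?sqr_ge0 ?invr_ge0 ?(ltW K4).
rewrite (gEB iY (gintZ _ iY2)) (gEZ _ iY2) (gEZ _ ipsi) in main.
rewrite EY -/B in main.
have : (4 * K)^-1 * B <= e.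
  have Kz : K != 0 by rewrite gt_eqF.
  rewrite [leRHS](_ : e = (4 * K)^-1 * (4 * (K * e))); last by field.
  by rewrite KE ler_wpM2l ?invr_ge0 ?mulr_ge0 ?(ltW K0)//; lra.
by rewrite /gauss_sm; lra.
Qed.

Lemma dist_cvg : dist n @[n --> \oo] --> 1 - gauss_sm s (@psi R) mu.
Proof.
have [L HL] := loglik_approx k beta0.
apply/cvgrPdist_le => /= e e0.
have e8 : 0 < e / 8 by rewrite divr_gt0.
have [K K0 HK] := truncated_mass e8.
(* [K] is chosen before [n], so the tolerances for [n] may absorb the factors [K] of the upper
   bound. *)
have eK : 0 < e / (8 * (1 + K)) by rewrite divr_gt0// mulr_gt0// addr_gt0.
near=> n.
have [n0 h1] : (0 < n)%N /\ `|psiE n mu - gauss_sm s (@psi R) mu| <= e / 8.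
  by near: n; exact: psi_clt.
have [_ h2] : (0 < n)%N /\ `|psiE n (mu + ln K) - gauss_sm s (@psi R) (mu + ln K)| <= e / (8 * (1 + K)).
  by near: n; exact: psi_clt.
have [_ h3] : (0 < n)%N /\ L * (Num.sqrt n%:R)^-1 <= e / (8 * (1 + K)).
  by near: n; exact: near_le_inv_sqrt.
have h4 := le_trans (HL n n0) h3; rewrite -/mu -/(logerr n) in h4.
have h5 := dist_le n0; have h6 := dist_ge n0 K0.
set g1 := gauss_sm s _ mu in h1 *; set gK := gauss_sm s _ (mu + ln K) in h2 HK.
set d := dTV_X _ _ in h5 h6 *.
have f1 : (1 + K) * (e / (8 * (1 + K))) = e / 8 by field; rewrite gt_eqF// addr_gt0.
have eK1 := eK; set e' := e / (8 * (1 + K)) in eK1 h2 h4 f1.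
have f2 : K * e' <= e / 8 by rewrite -f1 ler_wpM2r ?(ltW eK1)// lerDr.
have f3 : e' <= e / 8 by rewrite -f1 ler_peMl ?(ltW eK1)// lerDl ltW.
have f4 : K * logerr n <= e / 8 by rewrite (le_trans _ f2)// ler_wpM2l// ltW.
have f5 : `|K * psiE n (mu + ln K) - K * gK| <= e / 8.
  by rewrite -mulrBr normrM (gtr0_norm K0) (le_trans _ f2)// ler_wpM2l// ltW.
move: h1 f5; rewrite !ler_norml => /andP[? ?] /andP[? ?].
by apply/andP; split; lra.
Unshelve. all: by end_near. Qed.

(** Integrating [|1 - Y| = 1 + Y - 2 min(1, Y)] with [E Y = 1] gives [2 - 2 E psi(N)]. *)
Lemma limit_integral :
  ((2^-1)%:E * \int[normal_prob mu s]_x (`|1 - expR (- x)|)%:E)%E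
    = (1 - gauss_sm s (@psi R) mu)%:E.
Proof.
have s0 : 0 < s.
  by rewrite sqrtr_gt0 divr_gt0 ?mulr_gt0 ?exprn_gt0// ltr0n.
have ch : continuous (fun x : R => `|1 - expR (- x)|).
  move=> x; apply: cvg_norm; apply: cvgB; first exact: cvg_cst.
  apply: (cvg_comp _ (@expR R)); last exact: continuous_expR.
  by apply: cvgN; exact: cvg_id.
rewrite (ge0_integral_normal_prob_affine mu s0 ch)//.
have ip := gint_psi mu.
have absE y : `|1 - expR (- (mu + s * y))| = 1 + Y y - 2 * psi (mu + s * y).
  rewrite /Y /psi; case: (leP 1 (expR (- (mu + s * y)))) => h.
    by rewrite ler0_norm ?subr_le0//; ring.
  by rewrite gtr0_norm ?subr_gt0//; ring.
under eq_integral do rewrite absE.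
have i : gint (fun y => 1 + Y y - 2 * psi (mu + s * y)).
  by apply: gintB; [apply: gintD => //; exact: gint_cst|exact: gintZ].
have -> : (\int[normal_prob 0 1]_y (1 + Y y - 2 * psi (mu + s * y))%:E
    = (gE (fun y => 1 + Y y - 2 * psi (mu + s * y)))%:E)%E.
  by rewrite /gE /Rintegral fineK//; exact: integrable_fin_num.
rewrite gEB ?gEZ//; last 2 first.
- by apply: gintD => //; exact: gint_cst.
- exact: gintZ.
rewrite gED//; last exact: gint_cst.
rewrite gE_cst EY -EFinM; congr EFin; rewrite /gauss_sm; by field.
Qed.

End Comparison.

Theorem theorem2 (R : realType) (k : nat) (beta : R) :
  (0 < k)%N -> 0 < beta ->
  (fun n : nat =>
     (dTV_X (@law_alpha R n k (beta * Num.sqrt n%:R)) (@law_unif R n k))%:E)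
    @ \oo -->
  ((2^-1)%:E *
   \int[normal_prob (k%:R ^+ 2 / (4 * beta ^+ 2))
                    (Num.sqrt (k%:R ^+ 2 / (2 * beta ^+ 2)))]_x
      (`|1 - expR (- x)|)%:E)%E.
Proof.
move=> k0 beta0; rewrite limit_integral//.
by apply: cvg_EFin; [exact: nearW|exact: dist_cvg].
Qed.
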